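(* Let $n\ge 0$ and let $\Pi\subseteq\mathfrak{S}_n$. Suppose that the quasisymmetric generating function $Q(\Pi)$ is a symmetric function with power sum expansion $Q(\Pi)=q(p_1,p_2,p_3,\dots)=\sum_{\lambda\vdash n}c_\lambda p_\lambda$. Then: (a) $$\frac{(1+yt)^n}{(1-t)^{n+1}}P^{(\mathrm{lpk},\mathrm{des})}\left(\Pi;\frac{(1+y)^2t}{(y+t)(1+yt)},\frac{y+t}{1+yt}\right)=\sum_{k=0}^\infty\Theta_{y,k}(Q(\Pi)[X+1])\,t^k.$$ (b) $$\frac{(1+t)^n}{(1-t)^{n+1}}P^{\mathrm{lpk}}\left(\Pi;\frac{4t}{(1+t)^2}\right)=\sum_{k=0}^\infty\Theta_{1,k}(Q(\Pi)[X+1])\,t^k=\sum_{\lambda\vdash n}c_\lambda\frac{B_{o(\lambda)}(t)}{(1-t)^{o(\lambda)+1}}=\sum_{k=0}^n d_k\frac{B_k(t)}{(1-t)^{k+1}},$$ where $\sum_{k=0}^n d_kw^k=q(w,1,w,1,w,1,\dots)$.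
   Context: $\mathfrak{S}_n$ is the set of permutations $\pi=\pi(1)\cdots\pi(n)$ of $[n]=\{1,\dots,n\}$. An index $i\in[n-1]$ is a descent of $\pi$ if $\pi(i)>\pi(i+1)$; $\mathrm{des}(\pi)$ is the number of descents. An index $i\in\{2,\dots,n-1\}$ is a peak if $\pi(i-1)<\pi(i)>\pi(i+1)$; an index $i\in[n-1]$ is a left peak if $i$ is a peak, or if $i=1$ and $\pi(1)>\pi(2)$. $\mathrm{lpk}(\pi)$ is the number of left peaks. (For the empty permutation, $\mathrm{des}=\mathrm{lpk}=0$.) For $\Pi\subseteq\mathfrak{S}_n$ put $P^{(\mathrm{lpk},\mathrm{des})}(\Pi;y,t)=\sum_{\pi\in\Pi}y^{\mathrm{lpk}(\pi)}t^{\mathrm{des}(\pi)}$ and $P^{\mathrm{lpk}}(\Pi;t)=\sum_{\pi\in\Pi}t^{\mathrm{lpk}(\pi)}$. The type B Eulerian polynomials $B_n(t)$ are defined by $\frac{B_n(t)}{(1-t)^{n+1}}=\sum_{k=0}^\infty(2k+1)^nt^k$ for $n\ge 0$. Quasisymmetric generating function: $Q(\Pi)=\sum_{\pi\in\Pi}F_\pi$, where, for $\pi\in\mathfrak{S}_n$, $F_\pi=\sum x_{i_1}x_{i_2}\cdots x_{i_n}$, the sum being over all positive integers $i_1\le i_2\le\cdots\le i_n$ with $i_j<i_{j+1}$ whenever $j$ is a descent of $\pi$ (with $F_\pi=1$ for the empty permutation). $\Lambda$ is the $\mathbb{Q}$-algebra of symmetric functions in $x_1,x_2,\dots$; $p_i=\sum_jx_j^i$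 and $p_\lambda=p_{\lambda_1}p_{\lambda_2}\cdots$ are the power sums; $q$ denotes the polynomial expressing $Q(\Pi)$ in $p_1,p_2,\dots$; $o(\lambda)$ is the number of odd parts of a partition $\lambda$. Plethysm: for $a$ in a $\mathbb{Q}$-algebra of formal power series, $f\mapsto f[a]$ is the $\mathbb{Q}$-algebra homomorphism on $\Lambda$ such that $p_i[a]$ is obtained from $a$ by replacing every variable by its $i$th power. With $X=x_1+x_2+\cdots=p_1$, the map $f\mapsto f[X+1]$ is thus the homomorphism $\Lambda\to\Lambda$ with $p_i\mapsto p_i+1$. For $k\in\mathbb{Z}$, $\Theta_{y,k}(f)=f[k(1-\alpha)]\big|_{\alpha=-y}$, where $\alpha$ is a variable; that is, $\Theta_{y,k}$ is the $\mathbb{Q}$-algebra homomorphism on $\Lambda$ with $\Theta_{y,k}(p_i)=k(1-(-y)^i)$. $\Theta_{1,k}$ is the case $y=1$. Rational functions of $y,t$ are expanded as formal power series in $t$. *)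

(* Defs.v *)
From HB Require Import structures.
From mathcomp Require Import all_boot all_order all_algebra perm.
From mathcomp Require Import boolp classical_sets functions cardinality fsbigop.
From mathcomp Require Import finmap monalg.

Set Implicit Arguments.
Unset Strict Implicit.
Unset Printing Implicit Defensive.

Import GRing.Theory.
Local Open Scope ring_scope.

(* The variable x_j (j >= 1) has index j - 1.  A series is its family of       *)
(* coefficients; its product is the Cauchy product, not the pointwise product  *)
(* of functions.                                                               *)
Notation monom := {cmonom nat}.
Definition series := monom -> rat.

HB.instance Definition _ := GRing.Lmodule.copy series (monom -> rat^o).

Lemma finite_factor (m : monom) :
  finite_set [set ab : monom * monom | mmul ab.1 ab.2 = m].
Proof.
pose W := {ffun finsupp m -> 'I_(mdeg m).+1}.
pose h (u : W) : monom := [cmonom nat_of_ord (u i) | i : finsupp m]%M.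
have hP (a b : monom) : mmul a b = m -> exists u, a = h u.
  move=> e; exists [ffun i => inord (a (val i))].
  apply/eqP/cmP => i; rewrite cmE fsfun_ffun.
  case: insubP => [j ji <-|].
    rewrite /= ffunE inordK // ltnS.
    have am k : (a k <= m k)%N by rewrite -e cmM leq_addr.
    apply: leq_trans (am (val j)) _.
    by rewrite /mdeg (big_fsetD1 (val j)) //= leq_addr.
  by rewrite -cmE_eq0 -e cmM addn_eq0 => /andP[/eqP-> _].
apply: (@sub_finite_set _ _ [set (h uv.1, h uv.2) | uv in [set: W * W]]).
  case=> a b /= e; have [u ->] := hP _ _ e.
  have [|v ->] := hP b a; first by rewrite mulmC.
  by exists (u, v).
exact/finite_image/finite_finset.
Qed.

Definition series_mul (f g : series) : series := fun m =>
  \sum_(ab \in [set ab : monom * monom | mmul ab.1 ab.2 = m]) f ab.1 * g ab.2.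

Lemma mcoeffM_series (p q : {malg rat[monom]}) m :
  (p * q)@_m = series_mul (fun a => p@_a) (fun a => q@_a) m.
Proof.
rewrite /series_mul fsbig_finite; last exact: finite_factor.
set D := fset_set _.
pose d1 := (msupp p `|` [fset ab.1 | ab in D])%fset.
pose d2 := (msupp q `|` [fset ab.2 | ab in D])%fset.
rewrite (@mcoeffMlw _ _ d1 d2) ?fsubsetUl //.
transitivity (\sum_(ab <- [seq (a, b) | a <- d1, b <- d2]
    | mmul ab.1 ab.2 == m) p@_ab.1 * q@_ab.2).
  rewrite [RHS]big_mkcond big_allpairs; apply: eq_bigr => a _; apply: eq_bigr => b _.
  by case: ifP.
rewrite -[LHS]big_filter.
apply: perm_big; apply: uniq_perm; rewrite ?filter_uniq ?allpairs_uniq ?fset_uniq //.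
  by move=> [? ?] [? ?] _ _ /= [-> ->].
have inD ab : (ab \in D) = (mmul ab.1 ab.2 == m).
  rewrite in_fset_set; last exact: finite_factor.
  by apply/idP/eqP => [/set_mem|e] //; apply/mem_set.
move=> [a b]; rewrite mem_filter inD /=; case: eqP => //= e.
have abD : (a, b) \in D by rewrite inD e.
apply/allpairsP; exists (a, b); split=> //; rewrite !inE; apply/orP; right.
  by apply/imfsetP; exists (a, b).
by apply/imfsetP; exists (a, b).
Qed.

Lemma eq_series_mul (f f' g g' : series) m :
    (forall a b, mmul a b = m -> f a = f' a) ->
    (forall a b, mmul a b = m -> g a = g' a) ->
  series_mul f g m = series_mul f' g' m.
Proof.
move=> ff' gg'; rewrite /series_mul; apply: eq_fsbigr => -[a b].
move/set_mem => /= e; rewrite (ff' a b) // (gg' b a) //.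
by rewrite mulmC.
Qed.

Lemma mcoeff_sumU (D : {fset monom}) (f : series) a :
  (\sum_(b <- D) << f b *g b >>)@_a = if a \in D then f a else 0.
Proof.
rewrite raddf_sum /=.
under eq_bigr => b _ do rewrite mcoeffU.
case: ifPn => [aD|aD].
  rewrite (big_fsetD1 a) //= eqxx big1_fset ?addr0 // => c.
  by rewrite in_fsetD1 => /andP[/negPf ->].
by rewrite big1_fset // => c cD _; case: eqP aD cD => // -> /negPf ->.
Qed.

Lemma series_trunc (f : series) m :
  exists p : {malg rat[monom]}, forall a b, mmul a b = m -> f a = p@_a.
Proof.
exists (\sum_(a <- fset_set [set a | exists b, mmul a b = m]) << f a *g a >>).
move=> a b abm; rewrite mcoeff_sumU in_fset_set; last first.
  apply: sub_finite_set (finite_image fst (finite_factor m)) => c [g /= cg].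
  by exists (c, g).
by rewrite mem_set //; exists b.
Qed.

Lemma series_mulE (f g : series) (p q : {malg rat[monom]}) m :
    (forall a b, mmul a b = m -> f a = p@_a) ->
    (forall a b, mmul a b = m -> g a = q@_a) ->
  forall a b, mmul a b = m -> series_mul f g a = (p * q)@_a.
Proof.
move=> fp gq a b abm; rewrite mcoeffM_series; apply: eq_series_mul => c d cda.
  by apply: fp (mmul d b) _; rewrite mulmA cda.
by apply: gq (mmul d b) _; rewrite mulmA cda.
Qed.

Definition series_one : series := fun m => (m == mone)%:R.

Lemma series_mulC : commutative series_mul.
Proof.
move=> f g; apply/funext => m.
have [[p fp] [q gq]] := (series_trunc f m, series_trunc g m).
rewrite (series_mulE fp gq (mulm1 m)) (series_mulE gq fp (mulm1 m)).
by rewrite mulrC.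
Qed.

Lemma series_mulA : associative series_mul.
Proof.
move=> f g h; apply/funext => m.
have [[p fp] [q gq] [r hr]] :=
  And3 (series_trunc f m) (series_trunc g m) (series_trunc h m).
rewrite (series_mulE fp (series_mulE gq hr) (mulm1 m)).
by rewrite (series_mulE (series_mulE fp gq) hr (mulm1 m)) mulrA.
Qed.

Lemma series_mul1 : left_id series_one series_mul.
Proof.
move=> f; apply/funext => m; have [p fp] := series_trunc f m.
have oneE a b : mmul a b = m -> series_one a = (1 : {malg rat[monom]})@_a.
  by rewrite mcoeff1.
by rewrite (series_mulE oneE fp (mulm1 m)) mul1r -(fp _ _ (mulm1 m)).
Qed.

Lemma series_mulDl : left_distributive series_mul +%R.
Proof.
move=> f g h; apply/funext => m.
have [[p fp] [q gq] [r hr]] :=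
  And3 (series_trunc f m) (series_trunc g m) (series_trunc h m).
have DE a b : mmul a b = m -> (f + g) a = (p + q)@_a.
  by move=> ab; rewrite mcoeffD -(fp _ _ ab) -(gq _ _ ab).
transitivity (series_mul f h m + series_mul g h m); last by [].
rewrite (series_mulE DE hr (mulm1 m)) (series_mulE fp hr (mulm1 m)).
by rewrite (series_mulE gq hr (mulm1 m)) mulrDl mcoeffD.
Qed.

Lemma series_1neq0 : series_one != 0.
Proof.
by apply/eqP => /(congr1 (fun f : series => f mone)); rewrite /series_one eqxx.
Qed.

HB.instance Definition _ := GRing.Zmodule_isComNzRing.Build series
  series_mulA series_mulC series_mul1 series_mulDl series_1neq0.

Lemma series_scaleAl (c : rat) (f g : series) : c *: (f * g) = (c *: f) * g.
Proof.
apply/funext => m; have [[p fp] [q gq]] := (series_trunc f m, series_trunc g m).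
have ZE a b : mmul a b = m -> (c *: f) a = (c *: p)@_a.
  by move=> ab; rewrite mcoeffZ -(fp _ _ ab).
transitivity (c * series_mul f g m); first by [].
rewrite (series_mulE fp gq (mulm1 m)) -mcoeffZ scalerAl.
by rewrite -(series_mulE ZE gq (mulm1 m)).
Qed.

HB.instance Definition _ :=
  GRing.Lmodule_isLalgebra.Build rat series series_scaleAl.
HB.instance Definition _ := GRing.Lalgebra_isComAlgebra.Build rat series.

Section Permutations.
Variable n : nat.
Implicit Types (s : 'S_n) (i : nat).

(* pi s i is the letter \pi(i), for 1 <= i <= n. *)
Definition pi s i : nat := nth 0%N [seq (val (s j)).+1 | j <- enum 'I_n] i.-1.

Definition descent s i : bool := (0 < i < n)%N && (pi s i.+1 < pi s i)%N.

Definition peak s i : bool :=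
  [&& (1 < i < n)%N, (pi s i.-1 < pi s i)%N & (pi s i.+1 < pi s i)%N].

Definition left_peak s i : bool :=
  (0 < i < n)%N && (peak s i || (i == 1%N) && (pi s 2 < pi s 1)%N).

Definition des s : nat := count (descent s) (iota 1 n.-1).
Definition lpk s : nat := count (left_peak s) (iota 1 n.-1).

Definition P_lpk_des (R : comNzRingType) (Pi : {set 'S_n}) (y t : R) : R :=
  \sum_(s in Pi) y ^+ lpk s * t ^+ des s.

Definition P_lpk (R : comNzRingType) (Pi : {set 'S_n}) (t : R) : R :=
  \sum_(s in Pi) t ^+ lpk s.

End Permutations.

(* The series \sum_(u in A) x^(mon u), for a family in which every monomial    *)
(* occurs finitely often.                                                      *)
Definition sum_monom (T : choiceType) (A : set T) (mon : T -> monom) : series :=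
  fun m => \sum_(u \in A `&` [set u | mon u = m]) (1 : rat).

(* The index i_j is nth 0 u j.-1, as tuples are indexed from 0. *)
Definition F_word n (s : 'S_n) : set (n.-tuple nat) :=
  [set u | forall j, (0 < j < n)%N ->
     (nth 0 u j.-1 <= nth 0 u j)%N
     /\ (descent s j -> (nth 0 u j.-1 < nth 0 u j)%N)].

Definition qsym_F n (s : 'S_n) : series :=
  sum_monom (F_word s) (fun u => \big[mmul/mone]_(j <- u) ucm j).

Definition qsym_Q n (Pi : {set 'S_n}) : series := \sum_(s in Pi) qsym_F s.

Definition symmetric_function (f : series) : Prop :=
  (exists d, forall m, (d < mdeg m)%N -> f m = 0)
  /\ (forall sigma : nat -> nat, bijective sigma ->
      forall m m' : monom, (forall j, m' (sigma j) = m j) -> f m' = f m).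

Definition psum (i : nat) : series :=
  sum_monom setT (fun j : nat => expcmn (ucm j) i).

(* Partitions of n; the bounds on the length and on the parts hold for every   *)
(* partition of n and only serve to make the type finite.                      *)
Record intpart (n : nat) := IntPart {
  intpart_val : n.-bseq 'I_n.+1;
  _ : let s := [seq val i | i <- intpart_val] in
      [&& sorted geq s, 0%N \notin s & sumn s == n] }.

HB.instance Definition _ n := [isSub for @intpart_val n].
HB.instance Definition _ n := [Finite of intpart n by <:].

Definition parts n (la : intpart n) : seq nat :=
  [seq val i | i <- intpart_val la].

Definition psum_part n (la : intpart n) : series :=
  \prod_(i <- parts la) psum i.

Definition odd_parts n (la : intpart n) : nat := count odd (parts la).

(* Polynomials in p_1, p_2, ...: the indeterminate p_i has index i - 1, and    *)
(* psubst a q is q(a 1, a 2, ...).                                             *)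
Notation ppoly := {malg rat[{cmonom nat}]}.

Definition psubst (A : comAlgType rat) (a : nat -> A) (q : ppoly) : A :=
  mmap (in_alg A) (fun m : monom => \prod_(j <- finsupp m) a j.+1 ^+ m j) q.

(* The power sums are algebraically independent over the rationals and         *)
(* generate the algebra of symmetric functions, so a symmetric function f is   *)
(* psubst psum q for exactly one q.                                            *)
Definition ppoly_of (f : series) : ppoly := xget 0 [set q | f = psubst psum q].

(* f[a], where adams i replaces every variable by its i-th power. *)
Definition plethysm (A : comAlgType rat) (adams : nat -> A -> A) (a : A)
    (f : series) : A :=
  psubst (fun i => adams i a) (ppoly_of f).

Definition series_adams (i : nat) (f : series) : series :=
  fun m => \sum_(a \in [set a : monom | expcmn a i = m]) f a.

Definition poly_adams (i : nat) (p : {poly rat}) : {poly rat} := p \Po 'X^i.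

(* f[X + 1] *)
Definition plethysm_X1 (f : series) : series :=
  plethysm series_adams (psum 1 + 1) f.

(* The indeterminate 'X of {poly rat} is \alpha. *)
Definition Theta (R : comAlgType rat) (y : R) (k : int) (f : series) : R :=
  horner_alg (- y) (plethysm poly_adams (k%:~R * (1 - 'X)) f).

Section RationalExpansion.
Variable F : fieldType.

(* The rational function r is regular at 0, with Taylor series \sum_k a_k X^k. *)
Definition expands (r : {fraction {poly F}}) (a : nat -> F) : Prop :=
  exists u v : {poly F}, [/\ v`_0 != 0, r = tofrac u / tofrac v &
    forall m, u`_m = \sum_(i < m.+1) v`_i * a (m - i)%N].

End RationalExpansion.

(* (1 - X)^(n+1) \sum_k (2k+1)^n X^k, which has degree at most n. *)
Definition typeB_eulerian (n : nat) : {poly rat} :=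
  take_poly n.+1
    ((1 - 'X) ^+ n.+1 * \poly_(k < n.+1) (k.*2.+1 ^ n)%:R).

Lemma size_diff_shift (p : {poly rat}) N :
  (size p <= N.+1)%N -> (size (p - (p \Po ('X - 1)))%R <= N)%N.
Proof.
move=> sp; have s2 : size ('X - 1 : {poly rat}) = 2%N by rewrite -polyC1 size_XsubC.
have sq : size (p \Po ('X - 1)) = size p by apply: size_comp_poly2.
apply/leq_sizeP => j. rewrite leq_eqVlt. rewrite coefB => /predU1P[<-|Nj]; last first.
  by rewrite !nth_default ?subr0 ?sq // (leq_trans sp).
have [sN|Ns] := leqP (size p) N; first by rewrite !nth_default ?subr0 ?sq.
have e : N = (size p).-1 by rewrite (anti_leq (introT andP (conj sp Ns))).
have -> : (p \Po ('X - 1))`_N = lead_coef (p \Po ('X - 1)).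
  by rewrite lead_coefE sq -e.
rewrite {1}e -lead_coefE lead_coef_comp ?s2 // -polyC1 lead_coefXsubC expr1n mulr1.
by rewrite subrr.
Qed.

Lemma sum_coef_diff N m (p : {poly rat}) : (size p <= N <= m)%N ->
  \sum_(i < m.+1) ((1 - 'X) ^+ N)`_i * p.[(m - i)%:R] = 0.
Proof.
elim: N m p => [|N IH] m p.
  rewrite leqn0 size_poly_eq0 => /andP[/eqP-> _].
  by apply: big1 => i _; rewrite horner0 mulr0.
case/andP=> sp; case: m => // m; rewrite ltnS => Nm.
rewrite -[RHS](IH m.+1 (p - (p \Po ('X - 1)))); last first.
  by rewrite size_diff_shift // (leq_trans Nm).
have s1 : (size ((1 - 'X : {poly rat}) ^+ N) <= m.+1)%N.
  rewrite -[1 - 'X]opprB exprNn -signr_odd; case: odd.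
    by rewrite expr1 mulN1r size_polyN -polyC1 size_exp_XsubC ltnS.
  by rewrite expr0 mul1r -polyC1 size_exp_XsubC ltnS.
have hX x : ('X - 1 : {poly rat}).[x] = x - 1 by rewrite -polyC1 hornerXsubC.
under [RHS]eq_bigr => i _ do rewrite hornerD hornerN horner_comp hX mulrBr.
under [LHS]eq_bigr => i _ do rewrite exprSr mulrBr mulr1 coefB coefMX mulrBl.
rewrite !sumrB; congr (_ - _).
rewrite big_ord_recl mul0r add0r [RHS]big_ord_recr /= [X in X * _]nth_default //.
rewrite mul0r addr0; apply: eq_bigr => i _.
by rewrite subSS subSn ?leq_ord // -natr1 addrK.
Qed.

Lemma typeB_eulerianP n :
  expands (tofrac (typeB_eulerian n) / (1 - tofrac 'X) ^+ n.+1)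
    (fun k => (k.*2.+1 ^ n)%:R).
Proof.
exists (typeB_eulerian n), ((1 - 'X) ^+ n.+1).
have hC : ((1 - 'X : {poly rat}) ^+ n.+1)`_0 = 1.
  by rewrite -horner_coef0 horner_exp !hornerE expr1n.
split=> [||m]; first by rewrite hC oner_neq0.
  by rewrite rmorphXn rmorphB rmorph1.
rewrite /typeB_eulerian coef_take_poly ltnS; case: leqP => mn.
  rewrite coefM; apply: eq_bigr => i _.
  by rewrite coef_poly ltnS (leq_trans (leq_subr _ _) mn).
have := @sum_coef_diff n.+1 m ((2%:R *: 'X + 1) ^+ n).
have -> : size ((2%:R *: 'X + 1 : {poly rat}) ^+ n) = n.+1.
  have -> : 2%:R *: 'X + 1 = 2%:R *: ('X - (- 2%:R^-1)%:P) :> {poly rat}.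
    rewrite scalerBr -[2%:R *: _%:P]mul_polyC -polyCM mulrN divff // polyCN.
    by rewrite opprK.
  by rewrite exprZn size_scale ?expf_neq0 // size_exp_XsubC.
rewrite ltnSn mn => h; rewrite -[LHS](h isT); apply: eq_bigr => i _; congr (_ * _).
rewrite horner_exp !hornerE natrX.
rewrite -[(m - i).*2.+1%:R]natr1 -mul2n. by rewrite natrM.
Qed.

(* Main.v *)
Require Import Defs.
From HB Require Import structures.
From mathcomp Require Import all_boot all_order all_algebra perm.
From mathcomp Require Import boolp classical_sets functions cardinality fsbigop.
From mathcomp Require Import finmap monalg ring.

Set Implicit Arguments.
Unset Strict Implicit.
Unset Printing Implicit Defensive.

Import GRing.Theory.
Local Open Scope ring_scope.

(** Fix a permutation pi and a finite ordered list of letters, each of which has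
    a value and is either ordinary or super. Sum the products of the values over
    the weakly increasing words a_1 <= ... <= a_n in these letters, where an
    ordinary letter may be repeated only along ascents of pi and a super letter
    only along descents. With ordinary letters alone, this is the value of F_pi
    at finitely many variables. Let w b be the sum over words of length b (for
    the first b letters of pi). If w' is the sequence that belongs to the list
    extended by an ordinary letter of value z at its end, then

      w' (b+1) - z [b is an ascent] w' b = w (b+1) + z [b is a descent] w b,

    so exchanging ascents with descents and z with - z inverts the operator
    that sends w to w' ([step_inverse]). Hence a super letter of value y acts as
    the letter of value - y taken with multiplicity - 1, and contributes
    - (- y)^i to the i-th power sum.

    This gives the central fact, [pvalue_word_sum]: if Q(Pi) = q(p_1, p_2, ...),
    then q evaluated at the power sums of any list of ordinary and super letters
    is the sum over Pi of the word sums. For ordinary letters it is evaluation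
    of formal series at finitely many variables ([pvalue_power_sums]). To get a
    super letter y, insert m copies of the ordinary letter - y; both sides are
    polynomials in m which agree at all natural numbers, and hence at m = - 1
    ([iter_step_poly]). The same statement for the empty set of permutations
    shows that q may be replaced by any polynomial giving the same series
    ([pvalue_inj]), so the values of plethysms do not depend on the polynomials
    chosen to represent symmetric functions.

    Now Theta_{y,k}(f[X+1]) replaces p_i by 1 + k (1 - (- y)^i), the i-th power
    sum of an ordinary letter 1 followed by k pairs (super y, ordinary 1). For
    letters in this order, the generating function in k of the word sums can be
    computed for each pi separately, and it is a product over the positions of
    pi ([numerators], [act_words]): reading pi from left to right, with an
    ascent added at both ends, each position contributes a factor 1/(1 - t), and
    each position but the first also one of 1 + y t (ascent after ascent),
    t (1 + y) (descent after ascent), 1 + y (ascent after descent) or y + t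
    (descent after descent). As the left peaks are the starts of the maximal runs
    of descents, this product is the summand of pi on the left-hand side
    ([numerators_frac], [expands_lpk_des]).

    For y = 1 the point is p_i = 2k + 1 for odd i and p_i = 1 for even i, so
    p_lambda becomes (2k+1)^o(lambda), whose generating function is that of the
    type B Eulerian polynomial. The remaining equalities hold because a rational
    function is determined by its expansion ([expands_inj]). *)

(** * Substitution into polynomials in the power sums *)

Section MonomialEvaluation.
Variable (A : comNzRingType) (v : nat -> A).

Definition meval (m : monom) : A := \prod_(j <- finsupp m) v j ^+ m j.

Lemma mevalEw (d : {fset nat}) (m : monom) : (finsupp m `<=` d)%fset ->
  meval m = \prod_(j <- d) v j ^+ m j.
Proof.
move=> md; rewrite /meval (big_fset_incl _ md) // => j _.
by rewrite -cmE_eq0 => /eqP->; rewrite expr0.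
Qed.

Lemma meval1 : meval mone = 1.
Proof. by rewrite /meval mdom1 big_seq_fset0. Qed.

Lemma mevalM : {morph meval : m m' / mmul m m' >-> m * m'}.
Proof.
move=> m m'; rewrite {1}/meval mdomD.
rewrite (mevalEw (fsubsetUl _ (finsupp m'))) (mevalEw (fsubsetUr (finsupp m) _)).
by rewrite -big_split; apply: eq_bigr => j _; rewrite cmM exprD.
Qed.

Lemma mevalU j : meval (ucm j) = v j.
Proof. by rewrite /meval mdomU big_seq_fset1 cmUU expr1. Qed.

Lemma meval_prod (I : Type) (r : seq I) (F : I -> monom) :
  meval (\big[mmul/mone]_(i <- r) F i) = \prod_(i <- r) meval (F i).
Proof. exact: (big_morph meval mevalM meval1). Qed.

HB.instance Definition _ := isMultiplicative.Build _ _ meval (mevalM, meval1).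
End MonomialEvaluation.

Lemma expcmnS (m : monom) i : expcmn m i.+1 = mmul m (expcmn m i).
Proof. by case: i => [|i] //; rewrite mulm1. Qed.

Lemma expcmnE (m : monom) i j : expcmn m i j = (m j * i)%N.
Proof.
elim: i => [|i IH]; first by rewrite muln0 onecmE.
by rewrite expcmnS cmM IH mulnS.
Qed.

Lemma mevalX (A : comNzRingType) (v : nat -> A) m i :
  meval v (expcmn m i) = meval v m ^+ i.
Proof.
elim: i => [|i IH]; first by rewrite expr0 -[RHS](meval1 v).
by rewrite expcmnS mevalM IH exprS.
Qed.

Section Substitution.
Variable A : comAlgType rat.
Implicit Types (a : nat -> A) (q : ppoly).

Lemma psubst_meval a : psubst a = mmap (in_alg A) (meval (fun j => a j.+1)).
Proof. by []. Qed.

Lemma psubstB a : {morph psubst a : p q / p - q}.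
Proof. by move=> p q; rewrite psubst_meval raddfB. Qed.

Lemma psubstD1 a q : psubst a (q + 1) = psubst a q + 1.
Proof. by rewrite psubst_meval rmorphD rmorph1. Qed.

Lemma psubst_sum a (I : Type) (r : seq I) (P : pred I) (F : I -> ppoly) :
  psubst a (\sum_(i <- r | P i) F i) = \sum_(i <- r | P i) psubst a (F i).
Proof. by rewrite psubst_meval raddf_sum. Qed.

Lemma psubst_prod a (I : Type) (r : seq I) (F : I -> ppoly) :
  psubst a (\prod_(i <- r) F i) = \prod_(i <- r) psubst a (F i).
Proof. by rewrite psubst_meval rmorph_prod. Qed.

Lemma psubstZ a c q : psubst a (c *: q) = c *: psubst a q.
Proof. by rewrite psubst_meval mmapZ mulr_algl. Qed.

Lemma psubstU a j : psubst a << ucm j >> = a j.+1.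
Proof. by rewrite psubst_meval mmapU /= scale1r mul1r mevalU. Qed.

Lemma psubstE a q :
  psubst a q = \sum_(m <- msupp q) q@_m *: \prod_(j <- finsupp m) a j.+1 ^+ m j.
Proof. by rewrite /psubst mmapE; apply: eq_bigr => m _; rewrite mulr_algl. Qed.

Lemma eq_psubst a a' q : (forall i, (0 < i)%N -> a i = a' i) ->
  psubst a q = psubst a' q.
Proof.
move=> aa'; rewrite !psubstE; apply: eq_bigr => m _; congr (_ *: _).
by apply: eq_bigr => j _; rewrite aa'.
Qed.
End Substitution.

(** The rational numbers are taken as an algebra over themselves here once and for
    all, so that values are compared as plain rational numbers. *)
Definition pvalue (a : nat -> rat) (q : ppoly) : rat :=
  psubst (a : nat -> rat^o) q.

Lemma eq_pvalue a a' q : (forall i, (0 < i)%N -> a i = a' i) ->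
  pvalue a q = pvalue a' q.
Proof. exact: (@eq_psubst (rat^o : comAlgType rat)). Qed.

Lemma pvalueB a : {morph pvalue a : p q / p - q}.
Proof. exact: (@psubstB (rat^o : comAlgType rat)). Qed.

Lemma horner_psubst (a : nat -> {poly rat}) q z :
  (psubst a q).[z] = pvalue (fun i => (a i).[z]) q.
Proof.
rewrite /pvalue !psubstE horner_sum; apply: eq_bigr => m _.
rewrite hornerZ horner_prod.
by congr (_ * _); apply: eq_bigr => j _; rewrite horner_exp.
Qed.

Lemma psubst_comp (A : comAlgType rat) (a : nat -> A) (b : nat -> ppoly) q :
  psubst a (psubst b q) = psubst (fun i => psubst a (b i)) q.
Proof.
rewrite [psubst b q]psubstE psubst_sum psubstE; apply: eq_bigr => m _.
rewrite psubstZ psubst_prod; congr (_ *: _); apply: eq_bigr => j _.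
by rewrite psubst_meval rmorphXn.
Qed.

(** * Evaluation of series at finitely many variables *)

Lemma take_polyM (R : comNzRingType) d (p q : {poly R}) :
  take_poly d (take_poly d p * take_poly d q) = take_poly d (p * q).
Proof.
apply/polyP => i; rewrite !coef_take_poly; case: ifP => // id.
rewrite !coefM; apply: eq_bigr => j _; rewrite !coef_take_poly.
by rewrite (leq_ltn_trans (leq_ord j)) // (leq_ltn_trans (leq_subr _ _)).
Qed.

(** A series with infinitely many terms has no value at x, but its part of degree
    at most d has one: substitute x`_j *: 'X for the j-th variable, and 0 for the
    variables beyond the size of x, and keep the terms up to 'X^d. As only the
    coefficients at the divisors of one monomial, the box, matter, the series may
    be replaced by a polynomial with the same coefficients there. *)
Section TruncatedEvaluation.
Variables (x : seq rat) (d : nat).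

Definition box : monom := \big[mmul/mone]_(j <- iota 0 (size x)) expcmn (ucm j) d.

Lemma boxE j : box j = (if (j < size x)%N then d else 0%N).
Proof.
have -> : box j = (\sum_(i <- iota 0 (size x)) expcmn (ucm i) d j)%N.
  apply: (big_morph (fun m : monom => m j)) => [m m'|]; first exact: cmM.
  exact: cm1.
under eq_bigr => i _ do rewrite expcmnE cmU.
case: ifP => jx; last first.
  rewrite big_seq big1 // => i; rewrite mem_iota => /= ix.
  by case: eqP => // ij; rewrite -ij ix in jx.
rewrite (bigD1_seq j) ?iota_uniq ?mem_iota //= eqxx mul1n big1 ?addn0 // => i.
by move=> /negPf ->.
Qed.

Lemma dvd_box (a : monom) :
  (forall j, a j <= box j)%N -> exists b, mmul a b = box.
Proof.
move=> le; exists (divcm box a); apply/eqP/cmP => j.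
by rewrite cmM divcmE subnKC.
Qed.

Definition var_poly j : {poly rat} := x`_j *: 'X.

Lemma meval_var_poly m :
  meval var_poly m = meval (nth 0 x) m *: 'X^(mdeg m).
Proof.
rewrite /meval /mdeg; elim/big_rec3: _ => [|j a b c _ ->].
  by rewrite expr0 scale1r.
by rewrite exprZn exprD -!scalerAl -scalerAr scalerA.
Qed.

Definition eval_poly : {malg rat[monom]} -> {poly rat} :=
  mmap (in_alg {poly rat}) (meval var_poly).

(** A monomial that does not divide the box either involves a variable whose
    value is 0, or has degree above d. *)
Lemma take_eval0 (p : {malg rat[monom]}) :
  (forall a b, mmul a b = box -> p@_a = 0) -> take_poly d.+1 (eval_poly p) = 0.
Proof.
move=> p0; rewrite /eval_poly mmapE take_poly_sum big_seq big1 // => m mp.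
have /existsNP[j /negP] : ~ forall j, (m j <= box j)%N.
  by move=> /dvd_box[b /p0/eqP]; rewrite mcoeff_eq0 mp.
rewrite boxE mulr_algl take_polyZ meval_var_poly take_polyZ; case: ifP => jx.
  rewrite -ltnNge => dm; rewrite -['X^_]mul1r take_polyMXn.
  have -> : (d.+1 - mdeg m = 0)%N.
    apply/eqP; rewrite subn_eq0 (leq_trans dm) // mdegE.
    have jm : j \in finsupp m by rewrite -cmE_neq0 -lt0n (leq_ltn_trans _ dm).
    by rewrite (big_fsetD1 j) //= leq_addr.
  by rewrite take_poly0l mul0r !scaler0.
rewrite -ltnNge => m_gt0.
have jm : j \in finsupp m by rewrite -cmE_neq0 -lt0n.
rewrite {1}/meval (big_fsetD1 j) //= nth_default 1?leqNgt ?jx //.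
by rewrite expr0n gtn_eqF // mul0r !(scale0r, scaler0).
Qed.

Definition eval_series (f : series) : {poly rat} :=
  take_poly d.+1 (eval_poly (sval (cid (series_trunc f box)))).

Lemma eval_seriesE (f : series) (p : {malg rat[monom]}) :
    (forall a b, mmul a b = box -> f a = p@_a) ->
  eval_series f = take_poly d.+1 (eval_poly p).
Proof.
rewrite /eval_series; case: cid => p' /= fp' fp.
apply/eqP; rewrite -subr_eq0 -linearB -raddfB; apply/eqP.
by apply: take_eval0 => a b ab; rewrite mcoeffB -(fp' _ _ ab) -(fp _ _ ab) subrr.
Qed.

Lemma eval_series_sum (I : Type) (r : seq I) (P : pred I) (F : I -> series) :
  eval_series (\sum_(i <- r | P i) F i) = \sum_(i <- r | P i) eval_series (F i).
Proof.
apply: (big_morph eval_series) => [f g|].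
  rewrite [eval_series f]/eval_series [eval_series g]/eval_series.
  case: cid => p fp; case: cid => q gq /=.
  rewrite -take_polyD -raddfD; apply: eval_seriesE => a b ab.
  by rewrite mcoeffD -(fp _ _ ab) -(gq _ _ ab).
rewrite (@eval_seriesE _ 0) => [|a b _]; last by rewrite mcoeff0.
by rewrite /eval_poly raddf0 take_poly0r.
Qed.

Lemma eval_seriesZ c f : eval_series (c *: f) = c *: eval_series f.
Proof.
rewrite [eval_series f]/eval_series; case: cid => p fp /=.
have -> : c *: take_poly d.+1 (eval_poly p) = take_poly d.+1 (eval_poly (c *: p)).
  by rewrite -take_polyZ /eval_poly mmapZ mulr_algl.
apply: eval_seriesE => a b ab.
by rewrite mcoeffZ -(fp _ _ ab).
Qed.

Lemma eval_series_prod (I : Type) (r : seq I) (F : I -> series) :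
  eval_series (\prod_(i <- r) F i) =
  take_poly d.+1 (\prod_(i <- r) eval_series (F i)).
Proof.
elim: r => [|i r IH].
  rewrite !big_nil (@eval_seriesE _ 1) => [|a b _]; last by rewrite mcoeff1.
  by rewrite /eval_poly rmorph1.
rewrite !big_cons -take_polyM -IH.
move: (F i) (\prod_(j <- r) F j) => f g.
rewrite [eval_series f]/eval_series [eval_series g]/eval_series.
case: cid => p fp; case: cid => q gq /=.
rewrite [X in take_poly _ (X * _)]take_poly_id ?size_take_poly // take_polyM.
have -> : eval_poly p * eval_poly q = eval_poly (p * q).
  by rewrite /eval_poly rmorphM.
by apply: eval_seriesE; apply: series_mulE fp gq.
Qed.

End TruncatedEvaluation.

Section SeriesEvaluation.
Variables (x : seq rat) (d : nat).

Lemma eval_seriesX f k :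
  eval_series x d (f ^+ k) = take_poly d.+1 (eval_series x d f ^+ k).
Proof. have prodX (R : comNzRingType) (a : R) : a ^+ k = \prod_(i <- iota 0 k) a.
  by rewrite big_const_seq count_predT size_iota iter_mulr_1.
by rewrite !prodX eval_series_prod. Qed.

Lemma eval_series_psubst (a : nat -> series) q :
  eval_series x d (psubst a q) =
  take_poly d.+1 (psubst (fun i => eval_series x d (a i)) q).
Proof.
rewrite !psubstE eval_series_sum take_poly_sum; apply: eq_bigr => m _.
rewrite eval_seriesZ take_polyZ eval_series_prod; congr (_ *: _).
apply: (big_rec2 (fun p p' => take_poly d.+1 p = take_poly d.+1 p')) => // j p p' _.
move=> pp'; rewrite -[LHS]take_polyM -[RHS]take_polyM pp' eval_seriesX.
by rewrite [take_poly _ (take_poly _ (_ ^+ _))]take_poly_id ?size_take_poly.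
Qed.

(** A family in which only finitely many members divide the box is evaluated
    member by member. *)
Lemma eval_sum_monom (T : choiceType) (A : set T) (mon : T -> monom) (r : seq T) :
    uniq r -> (forall u, u \in r -> A u) ->
    (forall u b, A u -> mmul (mon u) b = box x d -> u \in r) ->
  eval_series x d (sum_monom A mon) =
  take_poly d.+1 (\sum_(u <- r) meval (nth 0 x) (mon u) *: 'X^(mdeg (mon u))).
Proof.
move=> r_uniq rA Ar.
rewrite (@eval_seriesE _ _ _ (\sum_(u <- r) << mon u >>)) => [|m b mb].
  rewrite /eval_poly [mmap _ _ _]raddf_sum; congr (take_poly _ _).
  by apply: eq_bigr => u _; rewrite [LHS]mmapU meval_var_poly /= scale1r mul1r.
rewrite /sum_monom /=.
have -> : (A `&` [set u | mon u = m] = [set` [seq u <- r | mon u == m]])%classic.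
  apply/seteqP; split=> u /=; rewrite mem_filter.
    by move=> [Au um]; rewrite um eqxx /= (Ar u b) // um.
  by move=> /andP[/eqP um /rA].
rewrite -fsbig_seq ?filter_uniq // big_filter big_mkcond raddf_sum.
by apply: eq_bigr => u _; rewrite /= mcoeffU; case: eqP.
Qed.

Lemma eval_psum i : (0 < i)%N ->
  eval_series x d (psum i) = take_poly d.+1 ((\sum_(z <- x) z ^+ i) *: 'X^i).
Proof.
move=> i_gt0; rewrite (@eval_sum_monom _ _ _ (iota 0 (size x))) ?iota_uniq //.
  congr (take_poly _ _); rewrite scaler_suml [RHS](big_nth 0) /index_iota subn0.
  apply: eq_bigr => j _; rewrite mevalX mevalU; congr (_ *: 'X^_).
  elim: {i_gt0} i => [|i IH]; first by rewrite mdeg1.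
  by rewrite expcmnS mdegM IH mdegU.
move=> j b _ /(congr1 (fun m : monom => m j)).
rewrite cmM expcmnE cmUU mul1n boxE mem_iota /= add0n; case: ltnP => // _.
by move/eqP; rewrite addn_eq0 gtn_eqF.
Qed.

End SeriesEvaluation.

(** * Words compatible with a descent set *)

(** If w b is the sum over the compatible words of length b in some list of
    letters, then step D z w b is the one after a letter of value z is added at
    the end of the list. A word of length b.+1 that uses the new letter is the
    new letter appended to a word of length b, and that word must avoid the new
    letter when b is a descent. *)
Fixpoint step (R : comNzRingType) (D : nat -> bool) (z : R) (w : nat -> R) b : R :=
  if b is b'.+1 then
    w b + z * (if D b' then w b' else step D z w b')
  else w 0%N.

Definition empty_word (R : comNzRingType) (b : nat) : R := (b == 0%N)%:R.

(** The recursion is that of [step], so that [sum_words] holds term by term. *)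
Fixpoint words (D : nat -> bool) N : nat -> seq (seq nat) :=
  if N is N'.+1 then
    fix words_N b := if b is b'.+1 then
        words D N' b ++
        [seq rcons u N' | u <- if D b' then words D N' b' else words_N b']
      else [:: [::]]
  else fun b => if b is 0%N then [:: [::]] else [::].

Definition compatible (D : nat -> bool) (u : seq nat) : Prop :=
  forall j, (0 < j < size u)%N ->
    (nth 0 u j.-1 <= nth 0 u j)%N /\ (D j -> (nth 0 u j.-1 < nth 0 u j)%N).

Lemma compatible_rcons D u a : compatible D (rcons u a) <->
  compatible D u /\ {in u, forall i, (i <= a)%N /\ (D (size u) -> (i < a)%N)}.
Proof.
split=> [cu|[cu ua] j].
  have cu' : compatible D u.
    move=> j /andP[j0 ju]; have := cu j; rewrite size_rcons !nth_rcons ju.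
    by rewrite (leq_ltn_trans (leq_pred j) ju) j0 ltnS ltnW //; apply.
  split=> // i /(nthP 0%N)[j ju <-].
  have u0 : (0 < size u)%N by apply: leq_ltn_trans ju.
  have := cu (size u); rewrite size_rcons ltnSn u0 !nth_rcons ltnn eqxx prednK //.
  rewrite leqnn => /(_ isT)[le lt].
  have u_sorted : sorted leq u.
    apply/(sortedP 0%N) => k ku; have := cu' k.+1.
    by rewrite /= ku => /(_ isT)[].
  have le_last : (nth 0 u j <= nth 0 u (size u).-1)%N.
    apply: (sorted_leq_nth leq_trans leqnn); rewrite ?inE ?ltn_predL //.
    by rewrite -ltnS prednK.
  by split=> [|/lt]; [apply: leq_trans le|apply: leq_ltn_trans le_last].
rewrite size_rcons ltnS [(j <= _)%N]leq_eqVlt => /andP[j0 /predU1P[ju|ju]].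
  rewrite !nth_rcons -ju ltnn eqxx prednK // leqnn.
  by move: ua; rewrite -ju; apply; rewrite mem_nth -?ju ?prednK.
rewrite !nth_rcons ju (leq_ltn_trans (leq_pred j)) //.
by apply: cu; rewrite j0.
Qed.

Lemma compatible_nil D : compatible D [::].
Proof. by move=> j; rewrite ltn0 andbF. Qed.

Lemma mem_words D N b u : u \in words D N b <->
  [/\ size u = b, {in u, forall i, i < N}%N & compatible D u].
Proof.
elim: N b u => [|N IHN] b u.
  have cnil := compatible_nil D.
  case: b => [|b] /=; first by rewrite inE; split=> [/eqP->|[/size0nil ->]].
  split=> // -[]; case: u => // i u _ /(_ i).
  by rewrite inE eqxx => /(_ isT).
elim: b u => [|b IHb] u.
  have cnil := compatible_nil D.
  by rewrite /= inE; split=> [/eqP->|[/size0nil ->]].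
have {}IHb v : v \in (if D b then words D N b else words D N.+1 b) <->
    [/\ size v = b, {in v, forall i, i <= N /\ (D b -> i < N)}%N & compatible D v].
  case: (D b).
    rewrite IHN; split=> -[vb vN cv]; split=> // i /vN.
      by move=> iN; split=> //; apply: ltnW.
    by case=> _; apply.
  rewrite IHb; split=> -[vb vN cv]; split=> // i /vN.
    by move=> iN; split.
  by case.
have -> : words D N.+1 b.+1 = words D N b.+1 ++
  [seq rcons u N | u <- if D b then words D N b else words D N.+1 b] by [].
rewrite mem_cat; split.
  case/orP=> [/IHN[ub uN cu]|/mapP[v /IHb[vb vN cv] ->]].
    by split=> // i /uN /ltnW; rewrite ltnS.
  split; first by rewrite size_rcons vb.
    by move=> i; rewrite mem_rcons inE ltnS => /predU1P[->|/vN[]].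
  by apply/compatible_rcons; split=> //; rewrite vb.
case: u / (lastP u) => [[]//|v a [/eqP + uN cu]].
rewrite size_rcons eqSS => /eqP vb.
move: cu => /compatible_rcons[cv va].
have : (a <= N)%N by rewrite -ltnS uN // mem_rcons inE eqxx.
rewrite leq_eqVlt => /predU1P[aN|aN].
  apply/orP; right; apply/mapP; exists v; last by rewrite aN.
  by apply/IHb; rewrite -vb -aN; split.
apply/orP; left; apply/IHN; split; first by rewrite size_rcons vb.
  move=> i; rewrite mem_rcons inE => /predU1P[-> //|/va[ia _]].
  exact: leq_ltn_trans aN.
by apply/compatible_rcons.
Qed.

Lemma words_uniq D N b : uniq (words D N b).
Proof.
elim: N b => [|N IHN] b; first by case: b.
elim: b => [//|b IHb].
have -> : words D N.+1 b.+1 = words D N b.+1 ++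
  [seq rcons u N | u <- if D b then words D N b else words D N.+1 b] by [].
rewrite cat_uniq IHN map_inj_uniq; last exact: rcons_injl.
have -> : uniq (if D b then words D N b else words D N.+1 b) by case: (D b).
rewrite andbT; apply/hasPn => _ /mapP[u _ ->]; apply/negP => /mem_words[_ /(_ N)].
by rewrite mem_rcons inE eqxx ltnn => /(_ isT).
Qed.

Lemma sum_words (R : comNzRingType) (x : nat -> R) D N b :
  \sum_(u <- words D N b) \prod_(j <- u) x j =
  foldl (fun w j => step D (x j) w) (empty_word R) (iota 0 N) b.
Proof.
elim: N b => [|N IHN] b.
  by case: b => [|b]; rewrite /= ?big_nil // big_seq1 big_nil.
rewrite -addn1 iotaD foldl_cat add0n /= addn1.
elim: b => [|b IHb].
  rewrite /= -IHN big_seq1 big_nil.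
  by case: N {IHN} => [|N]; rewrite big_seq1 big_nil.
have -> : words D N.+1 b.+1 = words D N b.+1 ++
  [seq rcons u N | u <- if D b then words D N b else words D N.+1 b] by [].
rewrite big_cat big_map IHN /=; congr (_ + _).
have -> : \sum_(u <- if D b then words D N b else words D N.+1 b)
    \prod_(j <- rcons u N) x j =
  x N * \sum_(u <- if D b then words D N b else words D N.+1 b) \prod_(j <- u) x j.
  by rewrite mulr_sumr; apply: eq_bigr => u _; rewrite big_rcons mulrC.
by congr (_ * _); case: (D b); rewrite ?IHN ?IHb.
Qed.

Lemma eval_qsym_F n (s : 'S_n) (x : seq rat) d :
  eval_series x d (qsym_F s) = take_poly d.+1
    (foldl (fun w z => step (descent s) z w) (empty_word rat) x n *: 'X^n).
Proof.
pose ws := words (descent s) (size x) n.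
have ws_size u : u \in ws -> size u = n by move=> /mem_words[].
pose r : seq (n.-tuple nat) := pmap insub ws.
have ws_r : [seq val u | u <- r] = ws.
  rewrite (pmap_filter (@insubK _ _ _)); apply/all_filterP/allP => u /ws_size un.
  by rewrite isSome_insub /= un.
have mem_r u : (u \in r) = (val u \in ws) by rewrite mem_pmap_sub.
rewrite (@eval_sum_monom _ _ _ _ _ r).
- congr (take_poly _ _).
  transitivity (\sum_(u <- ws) (\prod_(j <- u) x`_j) *: ('X^n : {poly rat})).
    rewrite -ws_r big_map; apply: eq_bigr => u _; rewrite meval_prod mdeg_prod.
    congr (_ *: 'X^_); first by apply: eq_bigr => j _; rewrite mevalU.
    under eq_bigr => j _ do rewrite mdegU.
    by rewrite sum1_size size_tuple.
  rewrite -scaler_suml sum_words; congr (_ n *: _).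
  rewrite -[in RHS](mkseq_nth 0 x) /mkseq.
  by elim: (iota 0 (size x)) (empty_word _) => //= j js IH w; rewrite IH.
- by rewrite pmap_sub_uniq // words_uniq.
- move=> u; rewrite mem_r => /mem_words[_ _ cu] j jn.
  by have := cu j; rewrite size_tuple => /(_ jn).
- move=> u b uF ub; rewrite mem_r; apply/mem_words; split.
  + exact: size_tuple.
  + move=> j ju; have := congr1 (fun m : monom => m j) ub; rewrite /= cmM boxE.
    case: ltnP => // _ /eqP; rewrite addn_eq0 (big_rem j) //= cmM cmUU.
    by rewrite add1n.
  + by move=> j; rewrite size_tuple; apply: uF.
Qed.

Lemma take_psubst d (a a' : nat -> {poly rat}) q :
    (forall i, (0 < i)%N -> take_poly d (a i) = take_poly d (a' i)) ->
  take_poly d (psubst a q) = take_poly d (psubst a' q).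
Proof.
move=> aa'; rewrite !psubstE !take_poly_sum; apply: eq_bigr => m _.
rewrite !take_polyZ; congr (_ *: _).
have takeM (p p' r r' : {poly rat}) : take_poly d p = take_poly d p' ->
    take_poly d r = take_poly d r' -> take_poly d (p * r) = take_poly d (p' * r').
  by move=> pp' rr'; rewrite -take_polyM pp' rr' take_polyM.
apply: (big_rec2 (fun p p' => take_poly d p = take_poly d p')) => // j p p' _ pp'.
apply: (takeM _ _ _ _ _ pp'); elim: (m j) => [|k IH]; first by rewrite !expr0.
by rewrite !exprS; apply: (takeM) => //; apply: aa'.
Qed.

(** Grading by powers of 'X makes both sides of psubst psum q = qsym_Q Pi finite:
    the truncations of their values agree in every degree, so the values agree. *)
Lemma pvalue_power_sums n (Pi : {set 'S_n}) q (x : seq rat) :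
    psubst psum q = qsym_Q Pi ->
  pvalue (fun i => \sum_(z <- x) z ^+ i) q =
  \sum_(s in Pi) foldl (fun w z => step (descent s) z w) (empty_word rat) x n.
Proof.
move=> qQ; set W := RHS.
have E : psubst (fun i => (\sum_(z <- x) z ^+ i) *: 'X^i) q = W *: 'X^n.
  apply/polyP => d.
  have /(congr1 (fun p : {poly rat} => p`_d)) :
      take_poly d.+1 (psubst (fun i => (\sum_(z <- x) z ^+ i) *: 'X^i) q) =
      take_poly d.+1 (W *: 'X^n).
    transitivity (eval_series x d (qsym_Q Pi)); last first.
      rewrite eval_series_sum /W scaler_suml take_poly_sum.
      by apply: eq_bigr => s _; rewrite eval_qsym_F.
    rewrite -qQ eval_series_psubst; apply: take_psubst => i i_gt0.
    rewrite eval_psum //.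
    by rewrite [RHS]take_poly_id ?size_take_poly.
  by rewrite !coef_take_poly ltnSn.
have := congr1 (fun p : {poly rat} => p.[1]) E.
rewrite hornerZ hornerXn expr1n mulr1 => <-; rewrite horner_psubst.
by apply: eq_pvalue => i _; rewrite hornerZ hornerXn expr1n mulr1.
Qed.

(** * Polynomial dependence on multiplicities *)

Lemma eq_poly_seq (x : nat -> rat) (p q : {poly rat}) : injective x ->
  (forall m, p.[x m] = q.[x m]) -> p = q.
Proof.
move=> x_inj pq; apply/eqP; rewrite -subr_eq0; apply: contraT => pq_neq0.
have := @max_poly_roots _ (p - q) [seq x i | i <- iota 0 (size (p - q))] pq_neq0.
rewrite size_map size_iota ltnn => -> //; last by rewrite map_inj_uniq ?iota_uniq.
by apply/allP => _ /mapP[m _ ->]; rewrite rootE hornerD hornerN pq subrr.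
Qed.

Lemma eq_poly_nat (p q : {poly rat}) :
  (forall m : nat, p.[m%:R] = q.[m%:R]) -> p = q.
Proof.
by apply: eq_poly_seq => i j /eqP; rewrite Num.Theory.eqr_nat => /eqP.
Qed.

(** Induction on the degree: the difference of a suitable multiple of 'X^(k.+1)
    has the same leading term as r. *)
Lemma sum_poly_nat (r : {poly rat}) :
  exists p : {poly rat}, forall m, p.[m%:R] = \sum_(k < m) r.[k%:R].
Proof.
have [k] := ubnP (size r); elim: k r => // k IH r; rewrite ltnS => rk.
case: k IH rk => [|k] IH rk.
  exists 0 => m; rewrite horner0 big1 // => i _.
  by move: rk; rewrite leqn0 size_poly_eq0 => /eqP->; rewrite horner0.
have sizeL :
    (size (('X + 1) ^+ k.+1 - 'X^(k.+1) - k.+1%:R *: 'X^k : {poly rat})%R <= k)%N.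
  rewrite exprDn !big_ord_recl /= !expr1n !mulr1 bin0 bin1 mulr1n subn0 subSS subn0.
  rewrite scaler_nat [X in X - _ - _]addrC addrK [X in X - _]addrC addrK.
  apply: (leq_trans (size_sum _ _ _)); apply/bigmax_leqP => i _.
  rewrite expr1n mulr1 -scaler_nat (leq_trans (size_scale_leq _ _)) // size_polyXn.
  by rewrite /bump /= !add1n !subSS ltn_subrL (leq_ltn_trans _ (ltn_ord i)).
pose G : {poly rat} := (r`_k / k.+1%:R) *: 'X^(k.+1).
have GE : G \Po ('X + 1) - G = r`_k *: 'X^k
    + (r`_k / k.+1%:R) *: (('X + 1) ^+ k.+1 - 'X^(k.+1) - k.+1%:R *: 'X^k).
  rewrite comp_polyZ comp_Xn_poly [in RHS]scalerBr scalerA.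
  rewrite divfK ?Num.Theory.pnatr_eq0 //.
  by rewrite [RHS]addrC subrK scalerBr.
have [|p pE] := IH (r - (G \Po ('X + 1) - G)).
  rewrite ltnS GE opprD addrA (leq_trans (size_polyD _ _)) // size_polyN geq_max.
  rewrite (leq_trans (size_scale_leq _ _)) // andbT.
  apply/leq_sizeP => j; rewrite leq_eqVlt coefB coefZ coefXn => /predU1P[<-|kj].
    by rewrite eqxx mulr1 subrr.
  by rewrite nth_default ?(leq_trans rk) // gtn_eqF // mulr0 subr0.
exists (p + G) => m; rewrite hornerD pE.
elim: m => [|m IHm].
  by rewrite !big_ord0 /G !hornerE expr0n mulr0.
have recr (F : nat -> rat) : \sum_(i < m.+1) F i = \sum_(i < m) F i + F m.
  exact: big_ord_recr.
rewrite (recr (fun i => r.[i%:R])) -IHm (recr (fun i => _.[i%:R])).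
rewrite /= !hornerD !hornerN !hornerD !hornerN.
rewrite horner_comp hornerD hornerX hornerC natr1.
by ring.
Qed.

Lemma eq_step (R : comNzRingType) D D' (z : R) w w' :
  D =1 D' -> w =1 w' -> step D z w =1 step D' z w'.
Proof.
by move=> DD' ww'; elim=> [|b IH] /=; rewrite ?ww' // IH DD'.
Qed.

Lemma rmorph_step (R S : comNzRingType) (g : {rmorphism R -> S}) D z w b :
  g (step D z w b) = step D (g z) (g \o w) b.
Proof.
elim: b => [|b IH] //=.
by rewrite rmorphD rmorphM; case: (D b); rewrite ?IH.
Qed.

(** The recursion of [step] is symmetric under exchanging the two sequences,
    descents with ascents, and z with - z. *)
Lemma step_inverse (R : comNzRingType) D (z : R) w :
  step (fun b => ~~ D b) (- z) (step D z w) =1 w.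
Proof.
elim=> [|b IH] //=.
by rewrite mulNr; case: (D b); rewrite /= ?IH addrK.
Qed.

(** Adding m letters of value z depends polynomially on m, because the differences
    in m of each term are given by earlier terms. The recursion then extends to
    all m, and its case m = - 1 says that the letter with multiplicity - 1 is the
    inverse of [step]. *)
Lemma iter_step_poly D (z : rat) w : exists p : nat -> {poly rat},
  (forall m b, iter m (step D z) w b = (p b).[m%:R]) /\
  step D z (fun b => (p b).[-1]) =1 w.
Proof.
have /choice[p pE] b : exists p : {poly rat},
    forall m, iter m (step D z) w b = p.[m%:R].
  elim: b => [|b [p pE]].
    by exists (w 0%N)%:P => m; rewrite hornerC; elim: m.
  pose r := z *: (if D b then p else p \Po ('X + 1)).
  have [P PE] := sum_poly_nat r; exists (P + (w b.+1)%:P) => m.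
  rewrite hornerD hornerC PE; elim: m => [|m IH]; first by rewrite big_ord0 add0r.
  rewrite big_ord_recr -addrA [_ + (w _)]addrC addrA -IH iterS.
  rewrite [LHS]/= -[step D z _ b]/(iter m.+1 (step D z) w b) !pE; congr (_ + _).
  rewrite hornerZ; congr (_ * _); case: (D b) => //.
  by rewrite horner_comp hornerD hornerX hornerC natr1.
exists p; split=> [m b|b]; first exact: pE.
have horner_step x : (step D z%:P p b).[x] = step D z (fun b => (p b).[x]) b.
  rewrite -[LHS]/(horner_eval x _) rmorph_step /= /horner_eval hornerC.
  exact: eq_step.
have E : step D z%:P p b = p b \Po ('X + 1).
  apply: eq_poly_nat => m; rewrite horner_step horner_comp hornerD hornerX hornerC.
  rewrite natr1 -pE iterS; apply: eq_step => // c; exact/esym/pE.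
rewrite -horner_step E horner_comp hornerD hornerX hornerC addNr.
by rewrite -(pE b 0%N).
Qed.

(** * Ordinary and super letters *)

(** The boolean of a letter tells whether it is ordinary. A super letter may be
    repeated along descents, so ascents and descents change roles. *)
Definition letter_step (R : comNzRingType) D (w : nat -> R) (l : bool * R) :=
  step (fun b => D b (+) ~~ l.1) l.2 w.

Definition letter_psum (R : comNzRingType) (l : bool * R) i : R :=
  if l.1 then l.2 ^+ i else - (- l.2) ^+ i.

Definition word_sum (R : comNzRingType) D (L : seq (bool * R)) : nat -> R :=
  foldl (letter_step D) (@empty_word R) L.

Lemma eq_foldl_step (R : comNzRingType) D (L : seq (bool * R)) w w' :
  w =1 w' -> foldl (letter_step D) w L =1 foldl (letter_step D) w' L.
Proof. by elim: L w w' => //= l L IH w w' ww'; apply/IH/eq_step. Qed.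

Lemma rmorph_foldl_step (R S : comNzRingType) (g : {rmorphism R -> S}) D L w b :
  g (foldl (letter_step D) w L b) =
  foldl (letter_step D) (g \o w) [seq (l.1, g l.2) | l <- L] b.
Proof.
elim: L w => //= l L IH w; rewrite IH; apply: eq_foldl_step => c /=.
exact: rmorph_step.
Qed.

(** Induction on the number of super letters: a super letter y behaves like m
    copies of the ordinary letter - y at m = - 1, both in its power sums and in the
    word sums. *)
Lemma pvalue_word_sum n (Pi : {set 'S_n}) q (L : seq (bool * rat)) :
    psubst psum q = qsym_Q Pi ->
  pvalue (fun i => \sum_(l <- L) letter_psum l i) q =
  \sum_(s in Pi) word_sum (descent s) L n.
Proof.
move=> qQ.
have [k] := ubnP (count (fun l => ~~ l.1) L); elim: k L => // k IH L Lk.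
have [Lord|] := boolP (all fst L).
  have -> : L = [seq (true, z) | z <- [seq l.2 | l <- L]].
    by elim: L Lord {Lk} => //= -[[] z] L IHL //= /IHL {1}->.
  move: [seq l.2 | l <- L] => x.
  transitivity (pvalue (fun i => \sum_(z <- x) z ^+ i) q).
    by apply: eq_pvalue => i _; rewrite big_map.
  rewrite (pvalue_power_sums _ qQ); apply: eq_bigr => s _.
  rewrite /word_sum; elim: x (empty_word rat) => //= z x IHx w.
  rewrite IHx; apply: eq_foldl_step => b; apply: eq_step => // {}b.
  by rewrite addbF.
rewrite -has_predC => /hasP[[[]//= y] /splitPr def_L _]; move: Lk.
case: L / def_L => L1 L2; rewrite count_cat /= addnS ltnS => Lk.
have {}IH m : pvalue (fun i => \sum_(l <- L1 ++ nseq m (true, - y) ++ L2)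
      letter_psum l i) q =
    \sum_(s in Pi) word_sum (descent s) (L1 ++ nseq m (true, - y) ++ L2) n.
  by apply: IH; rewrite !count_cat count_nseq /= mul0n add0n.
(* The multiplicity m of the value - y becomes the indeterminate. *)
have /choice[p pE] (s : 'S_n) :=
  iter_step_poly (descent s) (- y) (word_sum (descent s) L1).
pose lhs := psubst (fun i => (\sum_(l <- L1 ++ L2) letter_psum l i)%:P
  + ((- y) ^+ i)%:P * 'X) q.
pose rhs := \sum_(s in Pi)
  foldl (letter_step (descent s)) (p s) [seq (l.1, l.2%:P) | l <- L2] n.
have lhsE z : lhs.[z] =
    pvalue (fun i => \sum_(l <- L1 ++ L2) letter_psum l i + (- y) ^+ i * z) q.
  rewrite horner_psubst; apply: eq_pvalue => i _.
  by rewrite hornerD hornerM !hornerC hornerX.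
have rhsE z : rhs.[z] = \sum_(s in Pi)
    foldl (letter_step (descent s)) (fun b => (p s b).[z]) L2 n.
  rewrite horner_sum; apply: eq_bigr => s _.
  rewrite -[_.[z]]/(horner_eval z _) rmorph_foldl_step -map_comp.
  congr (foldl _ _ _ n); rewrite -[RHS]map_id; apply: eq_map => -[e c] /=.
  by rewrite /horner_eval hornerC.
have lr : lhs = rhs.
  apply: eq_poly_nat => m; rewrite lhsE rhsE.
  transitivity (pvalue (fun i => \sum_(l <- L1 ++ nseq m (true, - y) ++ L2)
      letter_psum l i) q).
    apply: eq_pvalue => i _.
    rewrite !big_cat /= big_nseq iter_addr_0 /letter_psum /=.
    by rewrite mulr_natr -addrA; congr (_ + _); apply: addrC.
  rewrite IH; apply: eq_bigr => s _; rewrite /word_sum !foldl_cat.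
  apply: eq_foldl_step => b; rewrite -(pE s).1 /word_sum.
  elim: m (foldl _ _ L1) b => // m IHm w b; rewrite iterSr -IHm /=.
  apply: eq_foldl_step => {}b; rewrite -[RHS]/(step _ _ _ _).
  by apply: eq_step => // {}b; rewrite addbF.
transitivity lhs.[-1].
  rewrite lhsE; apply: eq_pvalue => i _; rewrite !big_cat big_cons /=.
  by rewrite /letter_psum /= mulrN1 addrAC addrA.
rewrite lr rhsE; apply: eq_bigr => s _; rewrite /word_sum foldl_cat /=.
apply: eq_foldl_step => b.
rewrite -[LHS](step_inverse (descent s) (- y) (fun b => (p s b).[-1])) opprK.
by apply: eq_step => c; [rewrite addbT|apply: (pE s).2].
Qed.

(** * Plethysms as values at power sums *)

(** The difference of the two polynomials represents the zero series, which is
    the generating function of the empty set of permutations. *)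
Lemma pvalue_inj (L : seq (bool * rat)) q q' :
    psubst psum q = psubst psum q' ->
  pvalue (fun i => \sum_(l <- L) letter_psum l i) q =
  pvalue (fun i => \sum_(l <- L) letter_psum l i) q'.
Proof.
move=> qq'; apply/eqP; rewrite -subr_eq0 -pvalueB.
have q0 : psubst psum (q - q') = qsym_Q (@finset.set0 {perm 'I_0}).
  by rewrite psubstB qq' subrr /qsym_Q big_set0.
by rewrite (pvalue_word_sum L q0) big_set0.
Qed.

Lemma expcmn_inj i : (0 < i)%N -> injective (fun m : monom => expcmn m i).
Proof.
move=> i_gt0 m m' /= mm'; apply/eqP/cmP => j.
have /eqP := congr1 (fun m : monom => m j) mm'.
by rewrite /= !expcmnE eqn_pmul2r // => /eqP.
Qed.

Lemma series_adams_p1D1 i : (0 < i)%N -> series_adams i (psum 1 + 1) = psum i + 1.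
Proof.
move=> i_gt0; have injX := @expcmn_inj i i_gt0.
have one_i : expcmn (mone : monom) i = mone.
  by apply/eqP/cmP => j; rewrite expcmnE cm1.
apply/funext => m.
transitivity (psum i m + series_one m); last by [].
rewrite /series_adams.
have [[a ma]|nm] := pselect (exists a, expcmn a i = m).
  have -> : [set a0 : monom | expcmn a0 i = m]%classic = [set a]%classic.
    by apply/seteqP; split=> b /=; rewrite -ma; [move/injX|move->].
  rewrite fsbig_set1; transitivity (psum 1 a + series_one a); first by [].
  congr (_ + _); last by rewrite /series_one -ma -[in RHS]one_i (inj_eq injX).
  rewrite /psum /sum_monom; apply: eq_fsbigl; apply/seteqP.
  by split=> j [_ /= e]; split=> //=; move: e; rewrite -ma; [move->|move/injX].
have -> : [set a : monom | expcmn a i = m]%classic = set0%classic.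
  by apply/seteqP; split=> // a /= am; case: nm; exists a.
rewrite fsbig_set0 /series_one; case: eqP => [m1|_].
  by case: nm; exists mone; rewrite m1.
rewrite addr0 /psum /sum_monom [RHS]fsbig1 // => j [_ /= jm].
by case: nm; exists (ucm j).
Qed.

Lemma ppoly_ofP f q : f = psubst psum q -> psubst psum (ppoly_of f) = f.
Proof.
move=> fq; apply/esym/(@xgetPex _ 0 [set q | f = psubst psum q]%classic).
by exists q.
Qed.

(** With the letter (true, 1) in front, this is the alphabet 1 + k(1 - alpha) at
    alpha = - y. The letters then alternate, beginning and ending with an ordinary
    one, which corresponds to an ascent added at both ends of the permutation. *)
Definition alphabet (R : comNzRingType) (y : R) k : seq (bool * R) :=
  iter k (cat [:: (false, y); (true, 1)]) [::].

Lemma alphabetS (R : comNzRingType) (y : R) k :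
  alphabet y k.+1 = alphabet y k ++ [:: (false, y); (true, 1)].
Proof.
elim: k => // k IH; rewrite -[LHS]/([:: (false, y); (true, 1)] ++ alphabet y k.+1).
by rewrite {1}IH catA.
Qed.

Lemma map_alphabet (R S : comNzRingType) (g : {rmorphism R -> S}) y k :
  [seq (l.1, g l.2) | l <- alphabet y k] = alphabet (g y) k.
Proof. by elim: k => //= k ->; rewrite rmorph1. Qed.

Lemma rmorph_word_sum_alphabet (R S : comNzRingType) (g : {rmorphism R -> S})
    D y k b :
  g (word_sum D ((true, 1) :: alphabet y k) b) =
  word_sum D ((true, 1) :: alphabet (g y) k) b.
Proof.
rewrite /word_sum rmorph_foldl_step /= map_alphabet rmorph1.
apply: eq_foldl_step => {}b.
by apply: eq_step => // {}b /=; rewrite /empty_word rmorph_nat.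
Qed.

Lemma sum_alphabet (R : comNzRingType) (y : R) k i :
  \sum_(l <- alphabet y k) letter_psum l i = k%:R * (1 - (- y) ^+ i).
Proof.
elim: k => [|k IH]; first by rewrite big_nil mul0r.
rewrite /= !big_cons IH /letter_psum /= expr1n -nat1r mulrDl mul1r addrA.
by rewrite [- _ + 1]addrC.
Qed.

(** f[X + 1] is represented by the polynomial obtained from that of f by the
    substitution p_i |-> p_i + 1; [pvalue_inj] allows its use in place of the
    representative chosen by the plethysm. *)
Lemma pvalue_plethysm_X1 f q y k : f = psubst psum q ->
  (plethysm poly_adams (k%:R * (1 - 'X)) (plethysm_X1 f)).[- y] =
  pvalue (fun i => \sum_(l <- (true, 1) :: alphabet y k) letter_psum l i) q.
Proof.
move=> fq.
pose b i : ppoly := << ucm i.-1 >> + 1.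
have X1E : plethysm_X1 f = psubst psum (psubst b (ppoly_of f)).
  rewrite /plethysm_X1 /plethysm [RHS]psubst_comp; apply: eq_psubst => i i_gt0.
  by rewrite (series_adams_p1D1 i_gt0) /b psubstD1 psubstU prednK.
rewrite /plethysm horner_psubst.
have aE i : (poly_adams i (k%:R * (1 - 'X))).[- y] =
    \sum_(l <- alphabet y k) letter_psum l i.
  rewrite sum_alphabet /poly_adams horner_comp hornerXn.
  rewrite hornerM hornerD hornerN hornerX.
  by rewrite -polyC_natr -polyC1 !hornerC.
under eq_pvalue => i _ do rewrite aE.
rewrite (@pvalue_inj _ _ (psubst b (ppoly_of f))); last first.
  by rewrite (ppoly_ofP X1E).
rewrite [LHS]psubst_comp.
rewrite (@pvalue_inj _ q (ppoly_of f)); last by rewrite (ppoly_ofP fq).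
apply: eq_pvalue => i i_gt0.
rewrite psubstD1 psubstU (prednK i_gt0) big_cons addrC; congr (_ + _).
by rewrite /letter_psum /= expr1n.
Qed.

Lemma sum_alphabet1 k i :
  \sum_(l <- (true, 1 : rat) :: alphabet 1 k) letter_psum l i =
  if odd i then k.*2.+1%:R else 1.
Proof.
rewrite big_cons sum_alphabet {1}/letter_psum /= expr1n -signr_odd.
case: odd; rewrite ?expr1 ?expr0 ?subrr ?mulr0 ?addr0 //.
by rewrite opprK -natr1 -mul2n natrM mulrC addrC.
Qed.

(** * Expansions of rational functions *)

(** Polynomials act on sequences through the product with their generating
    function. *)
Section SeriesAction.
Variable F : nzRingType.
Implicit Types (p q : {poly F}) (a : nat -> F).

Definition act p a m : F := \sum_(i < m.+1) p`_i * a (m - i)%N.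

Lemma eq_act p a a' : a =1 a' -> act p a =1 act p a'.
Proof. by move=> aa' m; apply: eq_bigr => i _; rewrite aa'. Qed.

Lemma act_coef p a q m : (forall i, (i <= m)%N -> a i = q`_i) ->
  act p a m = (p * q)`_m.
Proof.
by move=> aq; rewrite coefM; apply: eq_bigr => i _; rewrite aq ?leq_subr.
Qed.

Lemma act_mul p q a : act (p * q) a =1 act p (act q a).
Proof.
move=> m; pose A := \poly_(k < m.+1) a k.
have aA i : (i <= m)%N -> a i = A`_i by rewrite coef_poly ltnS => ->.
rewrite (@act_coef _ _ A) // -mulrA; apply/esym/act_coef => i im.
by apply: act_coef => j ji; rewrite aA // (leq_trans ji).
Qed.

Lemma act_sum p (I : Type) (r : seq I) (P : pred I) (a : I -> nat -> F) m :
  act p (fun k => \sum_(i <- r | P i) a i k) m = \sum_(i <- r | P i) act p (a i) m.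
Proof.
rewrite /act exchange_big; apply: eq_bigr => j _; exact: mulr_sumr.
Qed.

Lemma act_linear c e a m : act (c%:P + e *: 'X) a m =
  c * a m + (if m is m'.+1 then e * a m' else 0).
Proof.
rewrite /act big_ord_recl coefD coefC coefZ coefX /= mulr0 addr0 subn0.
congr (_ + _); case: m => [|m]; first by rewrite big_ord0.
rewrite big_ord_recl big1 => [|i _]; rewrite /= coefD coefC coefZ coefX /=.
  by rewrite add0r mulr1 addr0 subSS subn0.
by rewrite mulr0 add0r mul0r.
Qed.
End SeriesAction.

Lemma expandsE (F : fieldType) (r : {fraction {poly F}}) a :
  expands r a <-> exists u v : {poly F},
    [/\ v`_0 != 0, r = tofrac u / tofrac v & act v a =1 nth 0 u].
Proof.
split=> -[u [v [v0 ruv uva]]]; exists u, v; split=> //.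
all: by move=> m; rewrite -uva.
Qed.

Lemma tofrac_neq0 (R : idomainType) (p : R) : p != 0 -> tofrac p != 0.
Proof. by rewrite tofrac_eq0. Qed.

Lemma expands_inj (F : fieldType) (r r' : {fraction {poly F}}) a :
  expands r a -> expands r' a -> r = r'.
Proof.
move=> /expandsE[u [v [v0 -> uva]]] /expandsE[u' [v' [v'0 -> uva']]].
have nz (w : {poly F}) : w`_0 != 0 -> tofrac w != 0.
  by move=> w0; apply: tofrac_neq0; apply: contraNneq w0 => ->; rewrite coef0.
apply/eqP; rewrite eqr_div ?nz // -!tofracM tofrac_eq; apply/eqP/polyP => m.
rewrite mulrC -(@act_coef _ _ (act v a)) => [|i _]; last exact: uva.
rewrite mulrC -[RHS](@act_coef _ _ (act v' a)) => [|i _]; last exact: uva'.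
by rewrite -!act_mul mulrC.
Qed.

Lemma eq_expands (F : fieldType) (r : {fraction {poly F}}) a a' :
  a =1 a' -> expands r a -> expands r a'.
Proof.
move=> aa' /expandsE[u [v [v0 ruv uva]]]; apply/expandsE; exists u, v.
by split=> // m; rewrite -uva; apply/esym/eq_act.
Qed.

Lemma expands0 (F : fieldType) : expands (0 : {fraction {poly F}}) (fun=> 0).
Proof.
exists 0, 1; split=> [||m]; first by rewrite coef1 oner_neq0.
  by rewrite tofrac0 mul0r.
by rewrite coef0 big1 // => i _; rewrite mulr0.
Qed.

Lemma expandsD (F : fieldType) (r r' : {fraction {poly F}}) a a' :
  expands r a -> expands r' a' -> expands (r + r') (fun k => a k + a' k).
Proof.
move=> /expandsE[u [v [v0 -> uva]]] /expandsE[u' [v' [v'0 -> uva']]].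
have nz (w : {poly F}) : w`_0 != 0 -> tofrac w != 0.
  by move=> w0; apply: tofrac_neq0; apply: contraNneq w0 => ->; rewrite coef0.
apply/expandsE; exists (u * v' + u' * v), (v * v'); split.
- by rewrite coef0M mulf_neq0.
- by rewrite addf_div ?nz // tofracD !tofracM.
- move=> m; rewrite coefD.
  have -> : act (v * v') (fun k => a k + a' k) m =
      act (v' * v) a m + act (v * v') a' m.
    by rewrite [v' * v]mulrC -big_split; apply: eq_bigr => i _; rewrite mulrDr.
  rewrite !act_mul (eq_act _ uva) (eq_act _ uva').
  rewrite !(@act_coef _ _ (nth 0 _) _ m (fun _ _ => erefl)).
  by rewrite mulrC [v * u']mulrC.
Qed.

Lemma expandsZ (F : fieldType) (r : {fraction {poly F}}) a c :
  expands r a -> expands (tofrac c%:P * r) (fun k => c * a k).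
Proof.
move=> /expandsE[u [v [v0 -> uva]]]; apply/expandsE; exists (c *: u), v; split=> //.
  by rewrite -mul_polyC tofracM mulrA.
move=> m; rewrite coefZ -uva mulr_sumr.
by apply: eq_bigr => i _; rewrite mulrCA.
Qed.

Lemma expands_sum (F : fieldType) (I : Type) (r : seq I)
    (f : I -> {fraction {poly F}}) a :
    (forall i, expands (f i) (a i)) ->
  expands (\sum_(i <- r) f i) (fun k => \sum_(i <- r) a i k).
Proof.
move=> fa; elim: r => [|i r IH].
  rewrite big_nil; apply: eq_expands (expands0 F) => k; by rewrite big_nil.
rewrite big_cons; apply: eq_expands (expandsD (fa i) IH) => k; by rewrite big_cons.
Qed.

(** * Generating functions and left peaks *)

Section LeftPeaks.
Variables (F : fieldType) (D : nat -> bool) (y : F).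
Hypothesis D0 : D 0%N = false.

Definition upto_ordinary k : nat -> F := word_sum D ((true, 1) :: alphabet y k).

(** The word sums over the alphabet cut off after its k-th super letter; for k = 0
    this must be the empty list, so that [upto_ordinaryE] holds uniformly. *)
Definition upto_super k : nat -> F :=
  if k is k'.+1 then step (fun b => ~~ D b) y (upto_ordinary k') else @empty_word F.

Lemma upto_ordinaryE k : upto_ordinary k =1 step D 1 (upto_super k).
Proof.
have stepD (w : nat -> F) : step (fun b => D b (+) false) 1 w =1 step D 1 w.
  by apply: eq_step => // b; rewrite addbF.
case: k => [|k]; first exact: stepD.
rewrite /upto_ordinary alphabetS /word_sum -cat_cons foldl_cat => b /=.
rewrite /letter_step /= stepD; apply: eq_step => // {}b.
by apply: eq_step => // {}b; rewrite addbT.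
Qed.

Lemma upto_ordinary0 k : upto_ordinary k 0 = 1.
Proof. by elim: k => [|k IH]; rewrite upto_ordinaryE //= IH. Qed.

Lemma upto_super0 k : upto_super k 0 = 1.
Proof. by case: k => //= k; rewrite upto_ordinary0. Qed.

Lemma upto_ordinaryS k b : upto_ordinary k b.+1 =
  upto_super k b.+1 + (if D b then upto_super k b else upto_ordinary k b).
Proof. by rewrite upto_ordinaryE /= mul1r upto_ordinaryE. Qed.

Lemma upto_superS k b : upto_super k.+1 b.+1 =
  upto_ordinary k b.+1 + y * (if D b then upto_super k.+1 b else upto_ordinary k b).
Proof. by rewrite /=; case: (D b). Qed.

(** The numerators, over (1 - t)^(b+1), of the generating functions in k of
    [upto_ordinary] and [upto_super]. *)
Fixpoint numerators b : {poly F} * {poly F} :=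
  if b is b'.+1 then
    let: (u, v) := numerators b' in
    if D b' then ((1 + y)%:P * v, (y%:P + 'X) * v)
    else ((1 + y *: 'X) * u, (1 + y) *: 'X * u)
  else (1, 1).

Lemma act_1X a m :
  act (1 - 'X : {poly F}) a m = a m - (if m is m'.+1 then a m' else 0).
Proof.
have -> : 1 - 'X = 1%:P + (-1) *: 'X :> {poly F} by rewrite scaleN1r polyC1.
by rewrite act_linear mul1r; case: m => [|m]; rewrite ?subr0 ?addr0 ?mulN1r.
Qed.

(** The two generating functions are always proportional to each other, so that
    one position of the permutation multiplies by a single polynomial. *)
Lemma act_words_rec b :
  let u p a a' := act p (fun k => a k b) =1 act (1 - 'X) (fun k => a' k b.+1) in
  if D b then u (1 + y)%:P upto_super upto_ordinary
              /\ u (y%:P + 'X) upto_super upto_super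
  else u (1 + y *: 'X) upto_ordinary upto_ordinary
              /\ u ((1 + y) *: 'X) upto_ordinary upto_super.
Proof.
have actC c a m : act (c%:P : {poly F}) a m = c * a m.
  rewrite -[c%:P]addr0 -(scale0r 'X) act_linear.
  by case: m => [|m]; rewrite ?mul0r addr0.
have act1 c a m : act (1 + c *: 'X : {poly F}) a m =
    a m + (if m is m'.+1 then c * a m' else 0).
  by rewrite -polyC1 act_linear mul1r.
have actX c a m : act (c *: 'X : {poly F}) a m =
    (if m is m'.+1 then c * a m' else 0).
  by rewrite -[c *: _]add0r -polyC0 act_linear mul0r add0r.
have actCX c a m : act (c%:P + 'X : {poly F}) a m =
    c * a m + (if m is m'.+1 then a m' else 0).
  by rewrite -['X]scale1r act_linear; case: m => // m; rewrite mul1r.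
have sup0S : upto_super 0 b.+1 = 0 by [].
(* The case k = 0 needs that no word in the empty list has length b, which is
   where a descent at b forces b to be positive. *)
case Db: (D b); split=> -[|k]; rewrite act_1X ?actC ?act1 ?actX ?actCX.
- have sup0 : upto_super 0 b = 0 by case: b Db {sup0S} => //; rewrite D0.
  by rewrite upto_ordinaryS Db sup0S sup0 mulr0 !addr0 subr0.
- by rewrite (upto_ordinaryS k.+1) upto_superS Db; ring.
- have sup0 : upto_super 0 b = 0 by case: b Db {sup0S} => //; rewrite D0.
  by rewrite sup0S sup0 mulr0 addr0 subr0.
- by rewrite upto_superS upto_ordinaryS Db; ring.
- by rewrite upto_ordinaryS Db sup0S add0r addr0 subr0.
- by rewrite (upto_ordinaryS k.+1) upto_superS Db; ring.
- by rewrite sup0S subr0.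
- by rewrite upto_superS upto_ordinaryS Db; ring.
Qed.

Lemma act_words b :
  act ((1 - 'X) ^+ b.+1) (fun k => upto_ordinary k b) =1 nth 0 (numerators b).1 /\
  act ((1 - 'X) ^+ b.+1) (fun k => upto_super k b) =1 nth 0 (numerators b).2.
Proof.
elim: b => [|b [IHo IHs]].
  have act_const a : a =1 (fun=> 1) ->
      act (1 - 'X : {poly F}) a =1 nth 0 (1 : {poly F}).
    move=> a1 [|m]; rewrite act_1X -[RHS]/((1 : {poly F})`__) coef1 !a1 ?subr0 //.
    by rewrite subrr.
  rewrite expr1.
  by split; apply: act_const => k; rewrite ?upto_ordinary0 ?upto_super0.
have step_act p (a a' : nat -> nat -> F) (u : {poly F}) :
    act ((1 - 'X) ^+ b.+1) (fun k => a k b) =1 nth 0 u ->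
    act p (fun k => a k b) =1 act (1 - 'X) (fun k => a' k b.+1) ->
    act ((1 - 'X) ^+ b.+2) (fun k => a' k b.+1) =1 nth 0 (p * u : {poly F}).
  move=> au pa m; rewrite exprSr act_mul.
  rewrite -(eq_act _ pa) -act_mul mulrC act_mul (eq_act _ au).
  exact: act_coef.
have := act_words_rec b; rewrite /=; case: (numerators b) IHo IHs => u v /= IHo IHs.
case: (D b) => -[ro rs]; split.
- exact: step_act IHs ro.
- exact: step_act IHs rs.
- exact: step_act IHo ro.
- exact: step_act IHo rs.
Qed.


Definition ndes b := count D (iota 0 b).
Definition nruns b := count (fun i => D i && ~~ D i.-1) (iota 0 b).

(** A run of descents contributes t (1 + y) at its first position, y + t at each
    further one, and 1 + y at the ascent after it. This ascent always exists,
    since the first component of [numerators] closes a run that is still open at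
    the end. The proof compares the two components after each position. *)
Lemma numerators_frac (K : fieldType) (g : {rmorphism {poly F} -> K}) b :
  let t := g 'X in
  let z := g y%:P in
  1 + z * t != 0 -> z + t != 0 ->
  g (numerators b).1 = (1 + z * t) ^+ b
    * ((1 + z) ^+ 2 * t / ((z + t) * (1 + z * t))) ^+ nruns b
    * ((z + t) / (1 + z * t)) ^+ ndes b.
Proof.
move=> t z nz1 nz2.
have num1 u : g ((1 + y *: 'X) * u) = (1 + z * t) * g u.
  by rewrite -mul_polyC !(rmorphM, rmorphD) rmorph1.
have num2 u : g ((1 + y)%:P * u) = (1 + z) * g u.
  by rewrite polyCD polyC1 !(rmorphM, rmorphD) rmorph1.
have num3 u : g ((y%:P + 'X) * u) = (z + t) * g u.
  by rewrite !(rmorphM, rmorphD).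
have num4 u : g ((1 + y) *: 'X * u) = (1 + z) * t * g u.
  by rewrite -mul_polyC -[_ * _ * u]mulrA num2 rmorphM mulrA.
clearbody t z.
case: b => [|b]; first by rewrite /= rmorph1 !expr0 !mulr1.
set X := _ / (_ * _); set Z := _ / _.
suff [] : g (numerators b.+1).1 =
    (1 + z * t) ^+ b.+1 * X ^+ nruns b.+1 * Z ^+ ndes b.+1 /\
  g (numerators b.+1).2 * (if D b then 1 + z else 1 + z * t) =
    g (numerators b.+1).1 * (if D b then z + t else (1 + z) * t) by [].
elim: b => [|b [IHu IHv]].
  rewrite /nruns /ndes /= D0 /= num1 num4 rmorph1 !expr0 !mulr1.
  by split=> //; ring.
have recN f c : count f (iota 0 c.+1) = (count f (iota 0 c) + f c)%N.
  by rewrite -addn1 iotaD count_cat /= addn0.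
rewrite /nruns /ndes !(recN _ b.+1) -/(nruns b.+1) -/(ndes b.+1).
rewrite -[numerators b.+2]/(let: (u, v) := numerators b.+1 in _).
case: (numerators b.+1) IHu IHv => u v /= IHu IHv.
case Db1: (D b.+1); last first.
  rewrite /= !addn0 num1 num4 exprS IHu; split; ring.
rewrite /= num2 num3 addn1; split; last by ring.
have ZE : z + t = (1 + z * t) * Z by rewrite /Z [RHS]mulrC divfK.
case: (D b) IHv => IHv; rewrite ?addn0 ?addn1 !(exprS _ b.+1) !(exprS _ (ndes _)).
  rewrite mulrC IHv IHu [X in _ * X = _]ZE; ring.
have XZE : (1 + z * t) * X * Z * (1 + z * t) = (1 + z) ^+ 2 * t.
  by rewrite /X /Z; field; rewrite nz1 nz2.
apply: (mulIf nz1); rewrite -[LHS]mulrA IHv IHu.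
transitivity ((1 + z * t) ^+ b.+1 * X ^+ nruns b.+1 * Z ^+ ndes b.+1
  * ((1 + z) ^+ 2 * t)).
  by ring.
by rewrite -XZE (exprS X); ring.
Qed.

End LeftPeaks.

Section Expansion.
Variables (F : fieldType) (n : nat) (y : F).

Lemma descent0 (s : 'S_n) : descent s 0 = false. Proof. by []. Qed.

Lemma des_ndes (s : 'S_n) : des s = ndes (descent s) n.
Proof.
by rewrite /des /ndes; case: n s.
Qed.

Lemma pi_inj (s : 'S_n) i j : (0 < i <= n)%N -> (0 < j <= n)%N ->
  Defs.pi s i = Defs.pi s j -> i = j.
Proof.
move=> /andP[i0 ni] /andP[j0 nj]; rewrite /Defs.pi => /eqP.
have word_size : size [seq (val (s j)).+1 | j <- enum 'I_n] = n.
  by rewrite size_map size_enum_ord.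
rewrite nth_uniq ?word_size ?prednK //; last first.
  rewrite map_inj_uniq ?enum_uniq // => a b [] /val_inj; exact: perm_inj.
by move=> /eqP ij; rewrite -(prednK i0) -(prednK j0) ij.
Qed.

Lemma lpk_nruns (s : 'S_n) : lpk s = nruns (descent s) n.
Proof.
have left_peakE i : left_peak s i = descent s i && ~~ descent s i.-1.
  rewrite /left_peak /descent /peak; case: i => [|[|i]] //=.
    by rewrite andbT; case: (1 < n)%N.
  rewrite orbF; have [ni|] //= := ltnP i.+2 n; rewrite (ltnW ni) /= andbC -leqNgt.
  congr (_ && _); rewrite [RHS]leq_eqVlt; case: eqP => //= /pi_inj.
  by rewrite (ltnW ni) (ltnW (ltnW ni)) => /(_ isT isT) /n_Sn.
by rewrite /lpk /nruns (eq_count left_peakE); case: n s {left_peakE}.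
Qed.

Lemma expands_lpk_des (Pi : {set 'S_n}) :
  let z : {fraction {poly F}} := tofrac y%:P in
  let t : {fraction {poly F}} := tofrac 'X in
  expands ((1 + z * t) ^+ n / (1 - t) ^+ n.+1
      * P_lpk_des Pi ((1 + z) ^+ 2 * t / ((z + t) * (1 + z * t)))
                     ((z + t) / (1 + z * t)))
    (fun k => \sum_(s in Pi) upto_ordinary (descent s) y k n).
Proof.
move=> z t; apply/expandsE.
exists (\sum_(s in Pi) (numerators (descent s) y n).1), ((1 - 'X) ^+ n.+1); split.
- rewrite -horner_coef0 horner_exp -polyC1 hornerD hornerC hornerN hornerX subr0.
  by rewrite expr1n oner_neq0.
- have coef_neq0 (p : {poly F}) i : p`_i != 0 -> tofrac p != 0.
    by move=> pi; apply: tofrac_neq0; apply: contraNneq pi => ->; rewrite coef0.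
  have nz1 : 1 + z * t != 0.
    rewrite -tofracM -tofrac1 -tofracD; apply: (@coef_neq0 _ 0%N).
    by rewrite coefD coef1 coefMX addr0 oner_neq0.
  have nz2 : z + t != 0.
    rewrite -tofracD; apply: (@coef_neq0 _ 1%N).
    by rewrite coefD coefC coefX add0r oner_neq0.
  rewrite tofracXn tofracB tofrac1 mulrAC; congr (_ / _).
  rewrite rmorph_sum mulr_sumr; apply: eq_bigr => s _ /=.
  by rewrite (numerators_frac (descent0 s) _ nz1 nz2) lpk_nruns des_ndes mulrA.
- move=> m; rewrite act_sum.
  transitivity (\sum_(s in Pi) (numerators (descent s) y n).1`_m).
    by apply: eq_bigr => s _; case: (act_words y (descent0 s) n) => ->.
  by rewrite -coef_sum.
Qed.

End Expansion.

(** * The two specialisations of Q(Pi) *)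

Lemma horner_alg_poly (a p : {poly rat}) : horner_alg a p = p \Po a.
Proof.
rewrite /horner_alg /horner_morph /comp_poly; congr (_.[_]).
by apply: eq_map_poly => c; apply: alg_polyC.
Qed.

Lemma horner_alg_rat (a : rat) (p : {poly rat}) : horner_alg (a : rat^o) p = p.[a].
Proof.
have map_id : map_poly (fun c : rat => c) p = p by apply: map_poly_id.
rewrite -[in RHS]map_id /horner_alg /horner_morph; congr (_.[_]).
by apply: eq_map_poly => c; apply: mulr1.
Qed.

Lemma Theta_horner k f y :
  (Theta ('X : {poly rat}) (k : nat) f).[y] =
  (plethysm poly_adams (k%:R * (1 - 'X)) f).[- y].
Proof. by rewrite /Theta horner_alg_poly horner_comp hornerN hornerX. Qed.

Lemma Theta1 k f :
  Theta (1 : rat^o) (k : nat) f = (plethysm poly_adams (k%:R * (1 - 'X)) f).[- 1].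
Proof. exact: horner_alg_rat. Qed.

Section SymmetricPi.
Variables (n : nat) (Pi : {set 'S_n}) (q : ppoly).
Hypothesis qQ : qsym_Q Pi = psubst psum q.

Lemma Theta_X1 k : Theta ('X : {poly rat}) (k : nat) (plethysm_X1 (qsym_Q Pi)) =
  \sum_(s in Pi) word_sum (descent s) ((true, 1) :: alphabet 'X k) n.
Proof.
apply: eq_poly_nat => m; rewrite Theta_horner (pvalue_plethysm_X1 _ _ qQ).
rewrite (pvalue_word_sum _ (esym qQ)) horner_sum; apply: eq_bigr => s _.
rewrite -[RHS]/(horner_eval _ _) rmorph_word_sum_alphabet /=.
by rewrite /horner_eval hornerX.
Qed.

Lemma Theta1_X1 k : Theta (1 : rat^o) (k : nat) (plethysm_X1 (qsym_Q Pi)) =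
  \sum_(s in Pi) word_sum (descent s) ((true, 1) :: alphabet 1 k) n.
Proof.
by rewrite Theta1 (pvalue_plethysm_X1 _ _ qQ) (pvalue_word_sum _ (esym qQ)).
Qed.
End SymmetricPi.

Section PowerSumExpansion.
Variables (n : nat) (c : intpart n -> rat).

Definition psum_poly : ppoly :=
  \sum_(la : intpart n) c la *: \prod_(i <- parts la) << ucm i.-1 >>.

Lemma part_gt0 (la : intpart n) i : i \in parts la -> (0 < i)%N.
Proof.
move=> ila; have /and3P[_ no0 _] := valP la.
by rewrite lt0n; apply: contra no0 => /eqP i0; rewrite -{1}i0.
Qed.

Lemma psubst_psum_poly (A : comAlgType rat) (a : nat -> A) :
  psubst a psum_poly = \sum_(la : intpart n) c la *: \prod_(i <- parts la) a i.
Proof.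
rewrite psubst_sum; apply: eq_bigr => la _; rewrite psubstZ psubst_prod.
congr (_ *: _); apply: eq_big_seq => i /part_gt0 i_gt0.
by rewrite psubstU prednK.
Qed.

Lemma pvalue_psum_poly k :
  pvalue (fun i => \sum_(l <- (true, 1) :: alphabet 1 k) letter_psum l i)
    psum_poly =
  \sum_(la : intpart n) c la * (k.*2.+1 ^ odd_parts la)%:R.
Proof.
rewrite [LHS]psubst_psum_poly; apply: eq_bigr => la _; congr (_ * _).
rewrite /odd_parts natrX; elim: (parts la) => [|i s IH]; first by rewrite big_nil.
rewrite big_cons IH exprD sum_alphabet1; congr (_ * _).
by case: odd.
Qed.

Lemma odd_parts_lt (la : intpart n) : (odd_parts la < n.+1)%N.
Proof.
rewrite ltnS (leq_trans (count_size _ _)) // size_map.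
exact: size_bseq.
Qed.

Lemma sum_odd_parts (V : zmodType) (h : intpart n -> nat -> V) :
  \sum_(k < n.+1) \sum_(la | odd_parts la == k) h la k =
  \sum_la h la (odd_parts la).
Proof.
rewrite (exchange_big_dep xpredT) //=; apply: eq_bigr => la _.
by rewrite (big_pred1 (Ordinal (odd_parts_lt la))) // => k; rewrite eq_sym.
Qed.
End PowerSumExpansion.

Lemma odd_natr_inj : injective (fun m : nat => m.*2.+1%:R : rat).
Proof.
by move=> i j /eqP; rewrite Num.Theory.eqr_nat eqSS -!mul2n eqn_pmul2l // => /eqP.
Qed.

Theorem theorem3p4 (n : nat) (Pi : {set 'S_n}) (q : ppoly)
    (c : intpart n -> rat) :
  symmetric_function (qsym_Q Pi) ->
  qsym_Q Pi = psubst psum q ->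
  qsym_Q Pi = \sum_(la : intpart n) c la *: psum_part la ->
  (let y : {fraction {poly {fraction {poly rat}}}} := tofrac (tofrac 'X)%:P in
   let t : {fraction {poly {fraction {poly rat}}}} := tofrac 'X in
   expands
     ((1 + y * t) ^+ n / (1 - t) ^+ n.+1
      * P_lpk_des Pi ((1 + y) ^+ 2 * t / ((y + t) * (1 + y * t)))
                     ((y + t) / (1 + y * t)))
     (fun k => tofrac (Theta 'X k (plethysm_X1 (qsym_Q Pi)))))
  /\
  (let t : {fraction {poly rat}} := tofrac 'X in
   let lhs := (1 + t) ^+ n / (1 - t) ^+ n.+1
              * P_lpk Pi (4%:R * t / (1 + t) ^+ 2) in
   let B k := tofrac (typeB_eulerian k) in
   [/\ expands lhs (fun k => Theta (1 : rat^o) k (plethysm_X1 (qsym_Q Pi))),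
       lhs = \sum_(la : intpart n) tofrac (c la)%:P
               * (B (odd_parts la) / (1 - t) ^+ (odd_parts la).+1)
     & exists d : 'I_n.+1 -> rat,
         \sum_(k < n.+1) d k *: 'X^k
           = psubst (fun i => if odd i then 'X else 1) q
         /\ \sum_(la : intpart n) tofrac (c la)%:P
               * (B (odd_parts la) / (1 - t) ^+ (odd_parts la).+1)
           = \sum_(k < n.+1) tofrac (d k)%:P * (B k / (1 - t) ^+ k.+1)]).
Proof.
move=> _ qQ cQ.
have cQ' : psubst psum (psum_poly c) = psubst psum q.
  by rewrite psubst_psum_poly -qQ cQ.
split=> [y t|t lhs B].
  apply: eq_expands (expands_lpk_des (tofrac 'X) Pi) => k.
  rewrite (Theta_X1 qQ) rmorph_sum; apply: eq_bigr => s _.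
  exact/esym/rmorph_word_sum_alphabet.
have lhs_expands :
    expands lhs (fun k => Theta (1 : rat^o) k (plethysm_X1 (qsym_Q Pi))).
  have := @expands_lpk_des rat n 1 Pi; rewrite /= polyC1 tofrac1 mul1r -/t => lhsE.
  have nzt : 1 + t != 0.
    rewrite -tofrac1 -tofracD; apply: tofrac_neq0.
    apply/eqP => /(congr1 (coefp 0%N)).
    by rewrite /= coefD coef1 coefX coef0 addr0 => /eqP; rewrite oner_eq0.
  have -> : lhs = (1 + t) ^+ n / (1 - t) ^+ n.+1
      * P_lpk_des Pi ((1 + 1) ^+ 2 * t / ((1 + t) * (1 + t))) ((1 + t) / (1 + t)).
    congr (_ * _); apply: eq_bigr => s _; rewrite (divff nzt) expr1n mulr1.
    by congr (_ ^+ _); congr (_ * _ / _); ring.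
  by apply: eq_expands lhsE => k; rewrite (Theta1_X1 qQ).
have rhs_expands : expands (\sum_(la : intpart n) tofrac (c la)%:P
    * (B (odd_parts la) / (1 - t) ^+ (odd_parts la).+1))
    (fun k => Theta (1 : rat^o) k (plethysm_X1 (qsym_Q Pi))).
  have := expands_sum (index_enum (intpart n)) (fun la : intpart n =>
    expandsZ (c la) (typeB_eulerianP (odd_parts la))).
  apply: eq_expands => k; rewrite -pvalue_psum_poly Theta1.
  rewrite (pvalue_plethysm_X1 _ _ qQ).
  exact: pvalue_inj cQ'.
split; [exact: lhs_expands|exact: expands_inj lhs_expands rhs_expands|].
exists (fun k : 'I_n.+1 => \sum_(la | odd_parts la == k) c la); split; last first.
  rewrite -(sum_odd_parts (fun la k => tofrac (c la)%:P * (B k / (1 - t) ^+ k.+1))).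
  by apply: eq_bigr => k _; rewrite 2!rmorph_sum mulr_suml.
(* At w = 2m + 1 the point (w, 1, w, 1, ...) consists of the power sums of an
   alphabet, so q may be replaced by the given power sum expansion. *)
apply: (eq_poly_seq odd_natr_inj) => m.
rewrite horner_psubst.
transitivity
  (pvalue (fun i => \sum_(l <- (true, 1) :: alphabet 1 m) letter_psum l i) q).
  rewrite -(pvalue_inj _ cQ') pvalue_psum_poly.
  rewrite -(sum_odd_parts (fun la k => c la * (m.*2.+1 ^ k)%:R)) horner_sum.
  by apply: eq_bigr => k _; rewrite hornerZ hornerXn mulr_suml -natrX.
apply: eq_pvalue => i _.
rewrite sum_alphabet1; case: (odd i); [exact/esym/hornerX|exact/esym/hornerC].
Qed.
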